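(* Let $P$ be the $\Bbbk\mathbb{S}_3$-module with basis $\{x,y,u,t,v,w\}$, where $x$ spans the trivial representation $W_\epsilon$, $y$ spans the sign representation $W_{\operatorname{sgn}}$, and $\{u,t\}$ and $\{v,w\}$ are canonical bases of two copies of the standard representation $W_{\operatorname{st}}$. Then $P$ is an $\mathcal{A}_1$-module via $$\Bbbk\{x,y,u,t\}\cong M(0,2\mathrm{i},1,1,0,0)[-\mathrm{i}],\qquad a_{12}\cdot v=x-2\mathrm{i}y+u+t+\mathrm{i}(v-w),$$ where the first condition means $a_{12}x=2\mathrm{i}(u-t)$, $a_{12}y=x+u+t$, $a_{12}u=a_{12}t=-\mathrm{i}(u-t)$. Moreover $P=P_{\operatorname{st}}(\mathrm{i})$ is the projective cover of the simple module $S_{\operatorname{st}}(\mathrm{i})$. As a result, $P_{\operatorname{st}}(-\frac{\mathrm{i}}3)\cong P_{\operatorname{st}}(\mathrm{i})\otimes S_{\operatorname{sgn}}$, $P_{\operatorname{st}}(\frac{\mathrm{i}}3)\cong S_{\operatorname{sgn}}\otimes P_{\operatorname{st}}(\mathrm{i})$ and $P_{\operatorname{st}}(-\mathrm{i})\cong S_{\operatorname{sgn}}\otimes P_{\operatorname{st}}(\mathrm{i})\otimes S_{\operatorname{sgn}}$.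
   Context: $\Bbbk$ is an algebraically closed field of characteristic zero, $\mathrm{i}=\sqrt{-1}\in\Bbbk$. $\mathcal{A}_1$ is the 72-dimensional Hopf algebra generated as an algebra by $H_t$ ($t\in\mathbb{S}_3$) and $a_{12},a_{13},a_{23}$ (indexed by the transpositions of $\mathbb{S}_3$; $H_{12}=H_{(12)}$, etc.), with relations $H_e=1$, $H_tH_s=H_{ts}$; $H_ta_i=\operatorname{sgn}(t)a_{tit^{-1}}H_t$; $a_{12}^2=0$; $a_{12}a_{23}+a_{23}a_{13}+a_{13}a_{12}=1-H_{12}H_{23}$; comultiplication $\Delta(H_t)=H_t\otimes H_t$, $\Delta(a_i)=H_i\otimes a_i+a_i\otimes1$. Since $a_{13}=-H_{23}a_{12}H_{23}$ and $a_{23}=-H_{13}a_{12}H_{13}$, a module is determined by the $\mathbb{S}_3$-action (via $t\mapsto H_t$) and the action of $a_{12}$; moreover $a_{12}w=-H_{12}a_{12}v$ whenever $H_{12}v=w$. The canonical basis $\{v,w\}$ of $W_{\operatorname{st}}$ satisfies $H_{12}v=w$, $H_{12}w=v$; $H_{23}v=v-w$, $H_{23}w=-w$; $H_{13}v=-v$, $H_{13}w=-v+w$. $S_{\operatorname{sgn}}$ is the one-dimensional module where $H_t$ acts by $\operatorname{sgn}(t)$ and all $a_i$ by $0$. $S_{\operatorname{st}}(\theta)$ is the simple module $W_{\operatorname{st}}$ with $a_{12}v=a_{12}w=\theta(v-w)$ for $\theta=\pm\mathrm{i}$, and with $a_{12}v=\theta(v+w)$, $a_{12}w=-\theta(v+w)$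 for $\theta=\pm\frac{\mathrm{i}}{3}$. $P_{\operatorname{st}}(\theta)$ denotes the projective cover of $S_{\operatorname{st}}(\theta)$, i.e. a projective module with an essential surjection onto it (no proper submodule maps onto $S_{\operatorname{st}}(\theta)$). *)

(* Defs.v *)
From HB Require Import structures.
From mathcomp Require Import all_boot all_order all_algebra all_fingroup.
From mathcomp Require Import ring.

Set Implicit Arguments.
Unset Strict Implicit.
Unset Printing Implicit Defensive.

Import GRing.Theory VectorInternalTheory.
Local Open Scope ring_scope.

(* {1, 2, 3} is encoded as 'I_3, shifted by one. *)
Definition o1 : 'I_3 := @Ordinal 3 0 isT.
Definition o2 : 'I_3 := @Ordinal 3 1 isT.
Definition o3 : 'I_3 := @Ordinal 3 2 isT.

Definition is_transp : pred 'S_3 :=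
  fun s => [exists i, exists j, (i != j) && (s == tperm i j)].

Definition transp := {s : 'S_3 | is_transp s}.

Fact is_transp_tperm (i j : 'I_3) : i != j -> is_transp (tperm i j).
Proof.
by move=> ij; apply/existsP; exists i; apply/existsP; exists j; rewrite ij eqxx.
Qed.

Definition t12 : transp := exist _ (tperm o1 o2) (@is_transp_tperm o1 o2 isT).
Definition t13 : transp := exist _ (tperm o1 o3) (@is_transp_tperm o1 o3 isT).
Definition t23 : transp := exist _ (tperm o2 o3) (@is_transp_tperm o2 o3 isT).

Fact is_transpJ (t : 'S_3) (s : transp) : is_transp (val s ^ t)%g.
Proof.
case: s => s /= /existsP[i /existsP[j /andP[ij /eqP->]]].
by rewrite tpermJ is_transp_tperm // (inj_eq perm_inj).
Qed.

(* MathComp composes permutations from left to right: s * t is "s, then t".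
   So the product ts of functions is (s * t)%g, and t s t^-1 is (s ^ t)%g. *)
Definition transpJ (t : 'S_3) (s : transp) : transp :=
  exist _ (val s ^ t)%g (is_transpJ t s).

Section Modules.

Variable k : fieldType.

Definition sgn (t : 'S_3) : k := (-1) ^+ odd_perm t.

Definition s3_action (V : lmodType k) (H : 'S_3 -> {linear V -> V}) : Prop :=
  (forall v, H 1%g v = v) /\ (forall s t v, H t (H s v) = H (s * t)%g v).

(* The defining relations of A_1, evaluated in End(V). *)
Record a1_relations (V : lmodType k)
    (H : 'S_3 -> {linear V -> V}) (a : transp -> {linear V -> V}) : Prop := {
  rel_H : s3_action H;
  rel_Ha : forall t s v, H t (a s v) = sgn t *: a (transpJ t s) (H t v);
  rel_sqr : forall v, a t12 (a t12 v) = 0;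
  rel_quad : forall v,
    a t12 (a t23 v) + a t23 (a t13 v) + a t13 (a t12 v)
    = v - H (val t12) (H (val t23) v) }.

(* A_1 is given by generators and relations: an action of A_1 on V consists of
   operators for the generators that satisfy the defining relations. *)
Record a1_action (V : lmodType k) := A1Action {
  actH : 'S_3 -> {linear V -> V};
  acta : transp -> {linear V -> V};
  actP : a1_relations actH acta }.

Record a1_module := A1Module {
  a1_space :> lmodType k;
  a1_act : a1_action a1_space }.

Record fd_a1_module := FDModule {
  fd_space :> vectType k;
  fd_act : a1_action fd_space }.

Definition fd_to_a1 (M : fd_a1_module) : a1_module := A1Module (fd_act M).
Local Coercion fd_to_a1 : fd_a1_module >-> a1_module.

Definition mH (M : a1_module) : 'S_3 -> {linear M -> M} := actH (a1_act M).
Definition ma (M : a1_module) : transp -> {linear M -> M} := acta (a1_act M).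

Definition a1_hom (M N : a1_module) (f : {linear M -> N}) : Prop :=
  (forall t v, f (mH M t v) = mH N t (f v)) /\
  (forall s v, f (ma M s v) = ma N s (f v)).

Definition a1_isom (M N : a1_module) : Prop :=
  exists2 f : {linear M -> N}, a1_hom f & bijective f.

Definition surjective (A B : Type) (f : A -> B) : Prop :=
  forall y, exists x, f x = y.

Record a1_submodule (M : a1_module) (U : M -> Prop) : Prop := {
  sub_0 : U 0;
  sub_D : forall v w, U v -> U w -> U (v + w);
  sub_Z : forall (c : k) v, U v -> U (c *: v);
  sub_H : forall t v, U v -> U (mH M t v);
  sub_a : forall s v, U v -> U (ma M s v) }.

Definition a1_essential (M N : a1_module) (f : {linear M -> N}) : Prop :=
  surjective f /\
  forall U : M -> Prop, a1_submodule U ->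
    (forall y, exists2 x, U x & f x = y) -> forall x, U x.

Definition a1_projective (P : a1_module) : Prop :=
  forall (M N : a1_module) (g : {linear M -> N}) (f : {linear P -> N}),
    a1_hom g -> surjective g -> a1_hom f ->
    exists2 h : {linear P -> M}, a1_hom h & forall v, g (h v) = f v.

Definition is_projective_cover (P S : a1_module) : Prop :=
  a1_projective P /\
  exists2 f : {linear P -> S}, a1_hom f & a1_essential f.

(* {v, w} satisfies the formulas of the canonical basis of W_st; linear
   independence is not part of this predicate. *)
Definition canonical_pair (V : lmodType k) (H : 'S_3 -> {linear V -> V})
    (v w : V) : Prop :=
  [/\ H (val t12) v = w /\ H (val t12) w = v,
      H (val t23) v = v - w /\ H (val t23) w = - w &
      H (val t13) v = - v /\ H (val t13) w = - v + w].


(* An A_1-module is determined by the S_3-action H and the action A of a_12: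
   a_s acts by sgn(g) H_g A H_g^-1 for any g with g (12) g^-1 = s. *)
Section OfA12.

Variables (V : lmodType k) (H : 'S_3 -> {linear V -> V}) (A : {linear V -> V}).

Definition transp_conjugator (s : transp) : 'S_3 :=
  if s == t12 then 1%g else if s == t13 then val t23 else val t13.

Definition a_of_a12 (s : transp) : {linear V -> V} :=
  let g := transp_conjugator s in sgn g \*: (H g \o A \o H (g^-1)%g).

Hypotheses (H_action : s3_action H)
  (HA12 : forall v, H (val t12) (A v) = - A (H (val t12) v))
  (A_sqr : forall v, A (A v) = 0)
  (A_quad : forall v,
    let a13 v := - H (val t23) (A (H (val t23) v)) in
    let a23 v := - H (val t13) (A (H (val t13) v)) in
    A (a23 v) + a23 (a13 v) + a13 (A v) = v - H (val t12) (H (val t23) v)).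

Lemma transpP (s : transp) : [\/ s = t12, s = t13 | s = t23].
Proof.
case: s => s Ps; case/existsP: (Ps) => i /existsP[j /andP[ij /eqP Es]].
have E (t : transp) : s = val t -> exist _ s Ps = t.
  by move=> Est; apply: val_inj.
case: i j ij Es => [[|[|[|//]]] Hi] [[|[|[|//]]] Hj] // _ Es;
  [apply: Or31|apply: Or32|apply: Or31|apply: Or33|apply: Or32|apply: Or33];
  apply: E; rewrite Es /=; try (congr tperm; exact: val_inj);
  rewrite [LHS]tpermC; congr tperm; exact: val_inj.
Qed.

Lemma transp_conjugatorP s : (val t12 ^ transp_conjugator s)%g = val s.
Proof.
rewrite /transp_conjugator.
have n1 : (t13 == t12) = false.
  apply/negbTE/eqP => /(congr1 val)/= /permP/(_ o1); by rewrite !tpermL.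
have n2 : (t23 == t12) = false.
  apply/negbTE/eqP => /(congr1 val)/= /permP/(_ o3); by rewrite tpermR tpermD.
have n3 : (t23 == t13) = false.
  apply/negbTE/eqP => /(congr1 val)/= /permP/(_ o1); by rewrite tpermL tpermD.
case: (transpP s) => ->; rewrite ?eqxx ?n1 ?n2 ?n3 ?conjg1 //= tpermJ.
- by rewrite tpermL tpermD.
- by rewrite tpermL tpermD // tpermC.
Qed.

Lemma cent_t12 (c : 'S_3) : (val t12 ^ c = val t12)%g -> c = 1%g \/ c = val t12.
Proof.
rewrite /= tpermJ => E.
have c3 : c o3 = o3.
  have := congr1 (fun s : 'S_3 => s (c o3)) E.
  rewrite tpermD ?(inj_eq perm_inj) //.
  case: tpermP => [->|->|] //.
  case: (c o3) => [[|[|[|//]]] p] N1 N2 _; last exact: val_inj.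
  - by case: N1; apply: val_inj.
  - by case: N2; apply: val_inj.
have c1 : c o1 != o3 by rewrite -c3 (inj_eq perm_inj).
have c2 : c o2 != o3 by rewrite -c3 (inj_eq perm_inj).
have c12 : c o1 != c o2 by rewrite (inj_eq perm_inj).
have ordP (x : 'I_3) : x != o3 -> x = o1 \/ x = o2.
  case: x => [[|[|[|//]]] p] //= _; [left|right]; exact: val_inj.
have cE (d : 'S_3) : c o1 = d o1 -> c o2 = d o2 -> o3 = d o3 -> c = d.
  move=> d1 d2 d3; apply/permP => x; case: x => [[|[|[|//]]] p].
  - by rewrite (_ : Ordinal p = o1) //; apply: val_inj.
  - by rewrite (_ : Ordinal p = o2) //; apply: val_inj.
  - by rewrite (_ : Ordinal p = o3) ?c3 //; apply: val_inj.
case: (ordP _ c1) (ordP _ c2) => [e1|e1] [e2|e2];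
  move: c12; rewrite e1 e2 ?eqxx // => _.
- by left; apply: cE; rewrite ?perm1.
- by right; apply: cE; rewrite ?tpermL ?tpermR // tpermD.
Qed.

Lemma sgnM s t : sgn (s * t)%g = sgn s * sgn t.
Proof. by rewrite /sgn odd_permM signr_addb. Qed.

Lemma sgn_transp (s : transp) : sgn (val s) = -1.
Proof.
by case: (transpP s) => ->; rewrite /sgn odd_tperm.
Qed.

Lemma a_of_a12_conj g v :
  a_of_a12 (transpJ g t12) v = sgn g *: H g (A (H (g^-1)%g v)).
Proof.
case: H_action => H1 HM.
set h := transp_conjugator (transpJ g t12).
have Eh : a_of_a12 (transpJ g t12) v = sgn h *: H h (A (H (h^-1)%g v)) by [].
rewrite Eh; have : ((val t12) ^ (h * g^-1) = val t12)%g.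
  by rewrite conjgM transp_conjugatorP /= -conjgM mulgV conjg1.
case/cent_t12 => [/(canRL (mulgK _))|/(canRL (mulgKV _))].
  by rewrite invgK mul1g => ->.
rewrite ?invgK => ->; rewrite sgnM sgn_transp invMg -!HM.
have inv12 : ((val t12)^-1 = val t12)%g by rewrite /= tpermV.
have H12K u : H (val t12) (H (val t12) u) = u.
  by rewrite HM -{1}inv12 mulVg H1.
by rewrite inv12 HA12 H12K linearN mulN1r scaleNr scalerN opprK.
Qed.

Fact a_of_a12_relations : a1_relations H a_of_a12.
Proof.
case: (H_action) => H1 HM.
have EJ s : exists g, s = transpJ g t12.
  exists (transp_conjugator s); apply: val_inj.
  by rewrite /= -[LHS]transp_conjugatorP.
have a12E v : a_of_a12 t12 v = A v.
  rewrite (_ : t12 = transpJ 1%g t12); last by apply: val_inj; rewrite /= conjg1.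
  by rewrite a_of_a12_conj invg1 !H1 /sgn odd_perm1 scale1r.
have a13E v : a_of_a12 t13 v = - H (val t23) (A (H (val t23) v)).
  rewrite (_ : t13 = transpJ (val t23) t12).
    by rewrite a_of_a12_conj sgn_transp /= tpermV scaleN1r.
  by apply: val_inj; rewrite /= tpermJ tpermL tpermD.
have a23E v : a_of_a12 t23 v = - H (val t13) (A (H (val t13) v)).
  rewrite (_ : t23 = transpJ (val t13) t12).
    by rewrite a_of_a12_conj sgn_transp /= tpermV scaleN1r.
  by apply: val_inj; rewrite /= tpermJ tpermL tpermD // tpermC.
split=> // [t s v|v|v].
- have [g ->] := EJ s.
  rewrite (_ : transpJ t (transpJ g t12) = transpJ (g * t)%g t12); last first.
    by apply: val_inj; rewrite /= conjgM.
  rewrite !a_of_a12_conj linearZ /= HM scalerA sgnM invMg HM mulKVg.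
  by rewrite mulrCA -[sgn t * sgn t]expr2 sqrr_sign mulr1.
- by rewrite !a12E.
- by rewrite !a12E !a13E !a23E; exact: A_quad.
Qed.

Definition action_of_a12 : a1_action V := A1Action a_of_a12_relations.

End OfA12.


Definition sgn_H (t : 'S_3) : {linear k^o -> k^o} := sgn t \*: idfun.
Definition sgn_a (s : transp) : {linear k^o -> k^o} := \0.

Fact sgn_relations : a1_relations sgn_H sgn_a.
Proof.
split.
- split=> [v|s t v]; rewrite /= ?/idfun; first by rewrite /sgn odd_perm1 scale1r.
  by rewrite scalerA sgnM mulrC.
- by move=> t s v; rewrite /= !scaler0.
- by [].
- move=> v; rewrite /= !addr0 scalerA.
  by rewrite -[tperm o1 o2]/(val t12) -[tperm o2 o3]/(val t23) !sgn_transp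
    mulrNN mulr1 scale1r subrr.
Qed.

Definition S_sgn : fd_a1_module := FDModule (A1Action sgn_relations).

(* W_st is the plane of sum-zero vectors in the permutation representation
   k^3, in the basis v = e_1 - e_3, w = e_2 - e_3: the coordinate of
   H_t (e_i - e_3) = e_(t i) - e_(t 3) at e_j - e_3 is the entry (i, j). *)
Definition st_mx (t : 'S_3) : 'M[k]_2 :=
  \matrix_(i < 2, j < 2)
    ((t (widen_ord (isT : 2 <= 3)%N i) == widen_ord (isT : 2 <= 3)%N j)%:R
     - (t o3 == widen_ord (isT : 2 <= 3)%N j)%:R).

Definition st_H (t : 'S_3) : {linear 'rV[k]_2 -> 'rV[k]_2} := mulmxr (st_mx t).

Definition st_v : 'rV[k]_2 := delta_mx 0 0.
Definition st_w : 'rV[k]_2 := delta_mx 0 1.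

Fact st_action : s3_action st_H.
Proof.
split=> [v|s t v]; rewrite /=.
  rewrite (_ : st_mx 1%g = 1%:M) ?mulmx1 //.
  apply/matrixP=> i j; rewrite !mxE !perm1.
  by case: i j => [[|[|//]] p] [[|[|//]] q]; rewrite /= ?subr0.
rewrite -mulmxA; congr (_ *m _); apply/matrixP=> i j; rewrite !mxE !permM.
set wj := widen_ord _ j; set wi := widen_ord _ i.
pose F (x : 'I_3) : k := ((s wi == x)%:R - (s o3 == x)%:R) *
  ((t x == wj)%:R - (t o3 == wj)%:R).
transitivity (\sum_x F x).
  rewrite [RHS]big_ord_recr /= [X in _ + X](_ : _ = 0); last first.
    by rewrite /F (_ : ord_max = o3) ?subrr ?mulr0 //; apply: val_inj.
  rewrite addr0; apply: eq_bigr => x _; rewrite !mxE /F.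
  rewrite (_ : widen_ord _ x = widen_ord (isT : 2 <= 3)%N x) //.
  exact: val_inj.
have sumd (y : 'I_3) :
    \sum_x (y == x)%:R * ((t x == wj)%:R - (t o3 == wj)%:R : k)
    = (t y == wj)%:R - (t o3 == wj)%:R.
  rewrite (bigD1 y) //= eqxx mul1r big1 ?addr0 // => x.
  by rewrite eq_sym => /negbTE->; rewrite mul0r.
rewrite (eq_bigr (fun x => (s wi == x)%:R * ((t x == wj)%:R - (t o3 == wj)%:R)
  - (s o3 == x)%:R * ((t x == wj)%:R - (t o3 == wj)%:R))); last first.
  by move=> x _; rewrite /F mulrBl.
by rewrite sumrB !sumd; ring.
Qed.

Lemma st_coord (x : 'rV[k]_2) : x = x 0 0 *: st_v + x 0 1 *: st_w.
Proof.
apply/rowP => j; rewrite !mxE.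
by case: j => [[|[|//]] p]; rewrite !(mulr1, mulr0, addr0, add0r) //=;
  congr (x _ _); apply: val_inj.
Qed.

Lemma st_canonical : canonical_pair st_H st_v st_w.
Proof.
have w0 : widen_ord (isT : 2 <= 3)%N 0 = o1 by apply: val_inj.
have w1 : widen_ord (isT : 2 <= 3)%N 1 = o2 by apply: val_inj.
have E (v w : 'rV[k]_2) : v 0 0 = w 0 0 -> v 0 1 = w 0 1 -> v = w.
  by move=> e0 e1; rewrite (st_coord v) (st_coord w) e0 e1.
have e13 : tperm o1 o2 o3 = o3 by rewrite tpermD.
have e31 : tperm o2 o3 o1 = o1 by rewrite tpermD.
have e22 : tperm o1 o3 o2 = o2 by rewrite tpermD.
by split; split; apply: E;
  rewrite /= -?rowE !mxE ?w0 ?w1 ?(e13, e31, e22, tpermL, tpermR) /=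
    ?(subrr, subr0, sub0r, oppr0, addr0, add0r).
Qed.

(* The parameters theta = +- i and theta = +- i/3. *)
Definition st_param (theta : k) : Prop :=
  theta ^+ 2 = -1 \/ (3%:R * theta) ^+ 2 = -1.

(* The rows are a_12 v and a_12 w: both are theta (v - w) when theta = +- i;
   otherwise they are theta (v + w) and - theta (v + w). *)
Definition st_a12_mx (theta : k) : 'M[k]_2 :=
  \matrix_(i < 2, j < 2)
    if theta ^+ 2 == -1 then (-1) ^+ j * theta else (-1) ^+ i * theta.

Definition st_a12 (theta : k) : {linear 'rV[k]_2 -> 'rV[k]_2} :=
  mulmxr (st_a12_mx theta).

Lemma st_a12_i theta : theta ^+ 2 = -1 ->
  st_a12 theta st_v = theta *: (st_v - st_w) /\
  st_a12 theta st_w = theta *: (st_v - st_w).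
Proof.
move=> h; split; apply/rowP=> j; rewrite /= -rowE !mxE h eqxx;
 by case: j => [[|[|//]] p] /=; ring.
Qed.

Lemma st_a12_i3 theta : theta ^+ 2 != -1 ->
  st_a12 theta st_v = theta *: (st_v + st_w) /\
  st_a12 theta st_w = - theta *: (st_v + st_w).
Proof.
move=> /negbTE h; split; apply/rowP=> j; rewrite /= -rowE !mxE h;
 by case: j => [[|[|//]] p] /=; ring.
Qed.

Section Sst.

Variables (theta : k) (theta_st : st_param theta).

Let cb (c d : k) : 'rV[k]_2 := c *: st_v + d *: st_w.

Let H12E c d : st_H (val t12) (cb c d) = cb d c.
Proof.
have [[e1 e2] _ _] := st_canonical.
by rewrite /cb linearD !linearZ e1 e2 /= addrC.
Qed.

Let H23E c d : st_H (val t23) (cb c d) = cb c (- c - d).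
Proof.
have [_ [e1 e2] _] := st_canonical.
rewrite /cb linearD !linearZ e1 e2 /= scalerBr !scalerN scalerBl scaleNr.
by rewrite -!addrA.
Qed.

Let H13E c d : st_H (val t13) (cb c d) = cb (- c - d) d.
Proof.
have [_ _ [e1 e2]] := st_canonical.
rewrite /cb linearD !linearZ e1 e2 /= scalerDr !scalerN scalerBl scaleNr.
by rewrite -!addrA.
Qed.

Let aE c d : st_a12 theta (cb c d) =
  if theta ^+ 2 == -1 then cb (theta * (c + d)) (- (theta * (c + d)))
  else cb (theta * (c - d)) (theta * (c - d)).
Proof.
case: ifP => [/eqP/st_a12_i|/negbT/st_a12_i3] [e1 e2];
  rewrite /cb linearD !linearZ e1 e2 /=;
  by apply/rowP=> j; rewrite !mxE; ring.
Qed.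

Let cbN c d : - cb c d = cb (- c) (- d).
Proof. by rewrite /cb opprD !scaleNr. Qed.

Let cbD c d c' d' : cb c d + cb c' d' = cb (c + c') (d + d').
Proof. by rewrite /cb !scalerDl addrACA. Qed.

Fact st_HA12 x :
  st_H (val t12) (st_a12 theta x) = - st_a12 theta (st_H (val t12) x).
Proof.
rewrite (st_coord x) -/(cb _ _) H12E !aE.
by case: ifP => _; rewrite H12E cbN; congr cb; ring.
Qed.

Fact st_A_sqr x : st_a12 theta (st_a12 theta x) = 0.
Proof.
rewrite (st_coord x) -/(cb _ _) aE.
case: ifP => E; rewrite aE E; rewrite -[RHS](scale0r st_v) -[RHS]addr0;
  by rewrite -[X in _ = _ + X](scale0r st_w) -/(cb _ _); congr cb; ring.
Qed.

Fact st_A_quad x :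
  let A := st_a12 theta in
  let a13 v := - st_H (val t23) (A (st_H (val t23) v)) in
  let a23 v := - st_H (val t13) (A (st_H (val t13) v)) in
  A (a23 x) + a23 (a13 x) + a13 (A x)
  = x - st_H (val t12) (st_H (val t23) x).
Proof.
move=> A a13 a23; rewrite {}/a13 {}/a23 {}/A (st_coord x) -/(cb _ _).
have E2 : (theta ^+ 2 == -1) = false -> (3%:R * theta) ^+ 2 = -1.
  by case: theta_st => [->|//]; rewrite eqxx.
case E: (theta ^+ 2 == -1);
  rewrite !(linearN, H12E, H13E, H23E, aE, E, cbN, cbD).
- by move/eqP: E => E; congr cb; ring: E.
- move/E2: E => E; congr cb.
    transitivity (- (3%:R * theta) ^+ 2 * (2%:R * x 0 0 + x 0 1)); first by ring.
    by rewrite E; ring.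
  transitivity (- (3%:R * theta) ^+ 2 * (x 0 1 - x 0 0)); first by ring.
  by rewrite E; ring.
Qed.

Definition S_st : fd_a1_module :=
  FDModule (action_of_a12 st_action st_HA12 st_A_sqr st_A_quad).

End Sst.

(* The tensor product of V and W over k, in coordinates: its elements are
   matrices, with pure tensors v (x) w given by the products v_i w_j. *)
Section Tensor.

Variables V W : vectType k.

Definition tens : Type := 'M[k]_(dim V, dim W).
HB.instance Definition _ := Vector.on tens.

Definition pure (v : V) (w : W) : tens := (v2r v)^T *m v2r w.

Definition vec_e (U : vectType k) (i : 'I_(dim U)) : U := r2v (delta_mx 0 i).

Lemma pure_linear_l (w : W) : linear (pure ^~ w).
Proof. by move=> c u v; rewrite /pure !linearP /= mulmxDl -scalemxAl. Qed.

Lemma pure_linear_r (v : V) : linear (pure v).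
Proof. by move=> c u w; rewrite /pure !linearP. Qed.

HB.instance Definition _ v :=
  GRing.isLinear.Build k W tens _ (pure v) (pure_linear_r v).

Definition pure_l (w : W) (v : V) : tens := pure v w.

HB.instance Definition _ w :=
  GRing.isLinear.Build k V tens _ (pure_l w) (pure_linear_l w).

Lemma tens_sum (X : tens) :
  X = \sum_i \sum_j X i j *: pure (vec_e i) (vec_e j).
Proof.
rewrite {1}[X]matrix_sum_delta; apply: eq_bigr => i _; apply: eq_bigr => j _.
by rewrite /pure /vec_e !r2vK trmx_delta mul_delta_mx.
Qed.

(* The linear map f (x) g. *)
Definition tens_map_fun (f : V -> V) (g : W -> W) (X : tens) : tens :=
  \sum_i \sum_j X i j *: pure (f (vec_e i)) (g (vec_e j)).

Fact tens_map_linear f g : linear (tens_map_fun f g).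
Proof.
move=> c X Y; rewrite /tens_map_fun scaler_sumr -big_split /=.
apply: eq_bigr => i _; rewrite scaler_sumr -big_split /=; apply: eq_bigr => j _.
by rewrite !mxE scalerDl scalerA.
Qed.

HB.instance Definition _ f g :=
  GRing.isLinear.Build k tens tens _ (tens_map_fun f g) (tens_map_linear f g).

Definition tens_map f g : {linear tens -> tens} := tens_map_fun f g.

Lemma tens_map_pure (f : {linear V -> V}) (g : {linear W -> W}) v w :
  tens_map f g (pure v w) = pure (f v) (g w).
Proof.
have vE (U : vectType k) (u : U) : u = \sum_i v2r u 0 i *: vec_e i.
  apply: (can_inj v2rK); rewrite linear_sum [LHS]row_sum_delta.
  by apply: eq_bigr => i _; rewrite linearZ /= r2vK.
have -> : pure (f v) (g w) = \sum_i v2r v 0 i *: pure (f (vec_e i)) (g w).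
  rewrite -/(pure_l _ _) {1}(vE V v) !linear_sum /=.
  by apply: eq_bigr => i _; rewrite !linearZ.
apply: eq_bigr => i _.
rewrite {2}(vE W w) !linear_sum /=; apply: eq_bigr => j _.
rewrite !linearZ /= scalerA; congr (_ *: _).
by rewrite /pure mxE big_ord1 mxE mulrC.
Qed.

Lemma pureDl v v' w : pure (v + v') w = pure v w + pure v' w.
Proof. exact: (linearD (pure_l w)). Qed.

Lemma pureNl v w : pure (- v) w = - pure v w.
Proof. exact: (linearN (pure_l w)). Qed.

Lemma pureZl c v w : pure (c *: v) w = c *: pure v w.
Proof. exact: (linearZ_LR (pure_l w)). Qed.

Lemma tens_ext (f g : {linear tens -> tens}) :
  (forall v w, f (pure v w) = g (pure v w)) -> f =1 g.
Proof.
move=> fg X; rewrite [X]tens_sum !linear_sum; apply: eq_bigr => i _.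
by rewrite !linear_sum; apply: eq_bigr => j _; rewrite !linearZ /= fg.
Qed.

End Tensor.

(* The comultiplication H_t |-> H_t (x) H_t, a_s |-> H_s (x) a_s + a_s (x) 1. *)
Section TensorModule.

Variables M N : fd_a1_module.

Let HM := actH (fd_act M).
Let aM := acta (fd_act M).
Let HN := actH (fd_act N).
Let aN := acta (fd_act N).

Definition tens_H (t : 'S_3) : {linear tens M N -> tens M N} :=
  tens_map (HM t) (HN t).

Definition tens_a (s : transp) : {linear tens M N -> tens M N} :=
  tens_map (HM (val s)) (aN s) \+ tens_map (aM s) idfun.

Lemma tens_H_pure t (m : M) (n : N) :
  tens_H t (pure m n) = pure (HM t m) (HN t n).
Proof. exact: tens_map_pure. Qed.

Lemma tens_a_pure s (m : M) (n : N) :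
  tens_a s (pure m n) = pure (HM (val s) m) (aN s n) + pure (aM s m) n.
Proof. by rewrite /= -!/(tens_map _ _ _) !tens_map_pure. Qed.

Fact tens_relations : a1_relations tens_H tens_a.
Proof.
case: (actP (fd_act M)) => -[M1 MM] Ma Msqr Mquad.
case: (actP (fd_act N)) => -[N1 NM] Na Nsqr Nquad.
split; first split.
- apply: (tens_ext (f := tens_H 1%g) (g := idfun)) => m n.
  by rewrite tens_H_pure M1 N1.
- move=> s t; apply: (tens_ext (f := tens_H t \o tens_H s)) => m n.
  by rewrite !tens_H_pure -MM -NM /= !tens_H_pure.
- move=> t s; apply: (tens_ext (f := tens_H t \o tens_a s)
    (g := sgn t \*: (tens_a (transpJ t s) \o tens_H t))) => m n.
  change (tens_H t (tens_a s (pure m n))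
    = sgn t *: tens_a (transpJ t s) (tens_H t (pure m n))).
  rewrite tens_a_pure tens_H_pure tens_a_pure linearD !tens_H_pure.
  rewrite /HM /aM /HN /aN !Ma !Na pureZl linearZ /= scalerDr; congr (_ *: pure _ _ + _).
  by rewrite !MM conjgE !mulgA mulgV mul1g.
- apply: (tens_ext (f := tens_a t12 \o tens_a t12) (g := \0)) => m n.
  change (tens_a t12 (tens_a t12 (pure m n)) = 0).
  rewrite !(tens_a_pure, linearD) /HM /aM /HN /aN Msqr Nsqr Ma sgn_transp.
  rewrite (_ : transpJ _ _ = t12); last by apply: val_inj; rewrite /= conjgE mulgA mulVg mul1g.
  have p0 : pure 0 n = 0 :> tens M N by rewrite -(scale0r (0 : M)) pureZl scale0r.
  by rewrite scaleN1r pureNl linear0 p0 add0r addr0 addrN.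
- apply: (tens_ext
    (f := (tens_a t12 \o tens_a t23) \+ (tens_a t23 \o tens_a t13)
          \+ (tens_a t13 \o tens_a t12))
    (g := idfun \- (tens_H (val t12) \o tens_H (val t23)))) => m n.
  change (tens_a t12 (tens_a t23 (pure m n))
    + tens_a t23 (tens_a t13 (pure m n)) + tens_a t13 (tens_a t12 (pure m n))
    = pure m n - tens_H (val t12) (tens_H (val t23) (pure m n))).
  have J1 : transpJ (val t12) t23 = t13.
    by apply: val_inj; rewrite /= tpermJ tpermR tpermD.
  have J2 : transpJ (val t23) t13 = t12.
    by apply: val_inj; rewrite /= tpermJ tpermR tpermD.
  have J3 : transpJ (val t13) t12 = t23.
    by apply: val_inj; rewrite /= tpermJ tpermL tpermD // tpermC.
  have E1 u : HM (val t23) (HM (val t13) u) = HM (val t12) (HM (val t23) u).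
    by rewrite !MM conjgC -[(val t13 ^ _)%g]/(val (transpJ (val t23) t13)) J2.
  have E2 u : HM (val t13) (HM (val t12) u) = HM (val t12) (HM (val t23) u).
    by rewrite !MM [in RHS]conjgC -[(val t23 ^ _)%g]/(val (transpJ (val t12) t23)) J1.
  rewrite !(tens_a_pure, linearD) /HM /aM /HN /aN !Ma J1 J2 J3 !sgn_transp.
  rewrite !scaleN1r !pureNl E1 E2.
rewrite [LHS](AC ((2*2)*(2*2)*(2*2))
    ((1*5*9)*(4*8*12)*(2*7)*(10*3)*(6*11)))%AC /=.
  rewrite !subrr !addr0 -!linearD -!pureDl /= Nquad Mquad !tens_H_pure.
  by rewrite linearB pureDl pureNl addrC addrA subrK.
Qed.

Definition tens_module : fd_a1_module := FDModule (A1Action tens_relations).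

End TensorModule.

(* "T is isomorphic to the projective cover of S", including its existence. *)
Definition isom_projective_cover (S T : a1_module) : Prop :=
  (exists Q, is_projective_cover Q S) /\
  forall Q, is_projective_cover Q S -> a1_isom Q T.

Lemma st_param_i (i : k) : i ^+ 2 = -1 -> st_param i.
Proof. by left. Qed.

Lemma st_param_Ni (i : k) : i ^+ 2 = -1 -> st_param (- i).
Proof. by left; rewrite sqrrN. Qed.

Lemma st_param_i3 (i : k) :
  [pchar k] =i pred0 -> i ^+ 2 = -1 -> st_param (i / 3%:R).
Proof.
by move=> /pcharf0P c0 i2; right; rewrite mulrC mulfVK ?c0.
Qed.

Lemma st_param_Ni3 (i : k) :
  [pchar k] =i pred0 -> i ^+ 2 = -1 -> st_param (- (i / 3%:R)).
Proof.
by move=> /pcharf0P c0 i2; right; rewrite mulrN sqrrN mulrC mulfVK ?c0.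
Qed.

End Modules.

Coercion fd_to_a1 : fd_a1_module >-> a1_module.

Arguments S_st {k} theta theta_st.

(* Main.v *)
(* A vector n of an A_1-module with H_23 n = n - H_12 n spans, together with
   H_12 n, a copy of W_st.  Taking the W_st-isotypic part of a_12 n gives two
   operators T+ and T- on such vectors, and the relations of A_1 imply
   T+ T- + T- T+ = 0, 9 T+^2 + T-^2 = -1 and T+ T- T+ T- = 0; hence
   T-^4 = - T-^2.  A vector n with T- n = i n satisfies all the formulas that
   describe v in P, so homomorphisms from P to M are the same as such vectors
   of M.  Since -(T-^2 - i T-^3)/2 is a natural projection onto them, they lift
   along surjections, and P is projective.  A submodule of P that maps onto
   S_st(i) contains a vector v + c u, on which T- + i is 2 i v, and v generates
   P.  Tensoring with S_sgn twists the action by signs, which is an invertible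
   operation and therefore preserves projective covers. *)

From HB Require Import structures.
Require Import Defs.
From mathcomp Require Import all_boot all_order all_algebra all_fingroup.
From mathcomp Require Import ring.
Set Implicit Arguments.
Unset Strict Implicit.
Unset Printing Implicit Defensive.
Import GRing.Theory.
Local Open Scope ring_scope.

(** * Linear identities in modules *)

Section ModuleNormalization.

Variables (k : fieldType) (V : lmodType k).

Inductive mexp :=
  | MVar of nat | MZero | MAdd of mexp & mexp | MOpp of mexp
  | MScale of k & mexp.

Fixpoint meval (env : seq V) (e : mexp) : V :=
  match e with
  | MVar n => nth 0 env n
  | MZero => 0
  | MAdd e1 e2 => meval env e1 + meval env e2
  | MOpp e1 => - meval env e1
  | MScale c e1 => c *: meval env e1
  end.

(** [eqn] instead of the generic [==] lets the index tests compute under the restricted [cbv] of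
    [module_coefs]. *)
Fixpoint mcoef (j : nat) (e : mexp) : k :=
  match e with
  | MVar n => if eqn n j then 1 else 0
  | MZero => 0
  | MAdd e1 e2 => mcoef j e1 + mcoef j e2
  | MOpp e1 => - mcoef j e1
  | MScale c e1 => c * mcoef j e1
  end.

Lemma meval_coef env e :
  meval env e = \sum_(j < size env) mcoef j e *: nth 0 env j.
Proof.
elim: e => [n||e1 IH1 e2 IH2|e IH|c e IH] /=.
- case: (ltnP n (size env)) => [ltn|gen].
    rewrite (bigD1 (Ordinal ltn)) //= (introT eqnP (erefl n)) scale1r.
    rewrite big1 ?addr0 // => j ne.
    case: eqnP => [E|]; last by rewrite scale0r.
    by case/eqP: ne; apply: val_inj.
  (* An index beyond the environment evaluates to the default 0, and its coefficient is never
     summed. *)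
  rewrite nth_default // big1 // => j _.
  case: eqnP => [E|]; last by rewrite scale0r.
  by move: (ltn_ord j); rewrite -E ltnNge gen.
- by rewrite big1 // => j _; rewrite scale0r.
- by rewrite IH1 IH2 -big_split; apply: eq_bigr => j _; rewrite scalerDl.
- by rewrite IH -sumrN; apply: eq_bigr => j _; rewrite scaleNr.
- by rewrite IH scaler_sumr; apply: eq_bigr => j _; rewrite scalerA.
Qed.

(** A recursive conjunction, so that it unfolds into finitely many scalar goals for [ring] or
    [field]. *)
Fixpoint mcoefs_eq (n : nat) (e1 e2 : mexp) : Prop :=
  if n is n'.+1 then mcoef n' e1 = mcoef n' e2 /\ mcoefs_eq n' e1 e2 else True.

Lemma meval_eq env e1 e2 :
  mcoefs_eq (size env) e1 e2 -> meval env e1 = meval env e2.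
Proof.
move=> E; rewrite !meval_coef; apply: eq_bigr => -[j ltj] _ /=; congr (_ *: _).
elim: (size env) E ltj => //= n IH [En /IH{}IH].
by rewrite ltnS leq_eqVlt => /predU1P[->|/IH].
Qed.

End ModuleNormalization.

(* [constr_eq] keeps distinct but convertible atoms apart without unfolding. *)
Ltac mlookup x env :=
  lazymatch env with
  | nil => constr:(@None nat)
  | cons ?y ?env' =>
    match constr:(tt) with
    | _ => let _ := match constr:(tt) with _ => constr_eq x y end in constr:(Some 0%N)
    | _ => match mlookup x env' with
           | Some ?n => constr:(Some (S n))
           | None => constr:(@None nat)
           end
    end
  end.

Ltac matoms env x :=
  lazymatch x with
  | @GRing.add _ ?a ?b => let env := matoms env a in matoms env b
  | @GRing.opp _ ?a => matoms env a
  | @GRing.scale _ _ _ ?a => matoms env a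
  | @GRing.zero _ => env
  | _ => match mlookup x env with
         | None => constr:(cons x env)
         | _ => env
         end
  end.

Ltac mquote k env x :=
  lazymatch x with
  | @GRing.add _ ?a ?b =>
    let a := mquote k env a in let b := mquote k env b in constr:(@MAdd k a b)
  | @GRing.opp _ ?a => let a := mquote k env a in constr:(@MOpp k a)
  | @GRing.scale _ _ ?c ?a =>
    let a := mquote k env a in constr:(@MScale k c a)
  | @GRing.zero _ => constr:(@MZero k)
  | _ => match mlookup x env with
         | Some ?n => constr:(@MVar k n)
         end
  end.

(* Reduces an equation in V to the equality of the coefficients of its atoms. *)
Ltac module_coefs k V :=
  lazymatch goal with
  | |- ?x = ?y =>
    let env := matoms (@nil V) x in
    let env := matoms env y in
    let x' := mquote k env x in
    let y' := mquote k env y in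
    refine (@meval_eq k V env x' y' _);
    cbv [mcoefs_eq mcoef eqn size];
    repeat (match goal with |- _ /\ _ => split | |- True => exact I end)
  end.

(** Here and in [scaler_cancel], a known equation l = r is used linearly: what remains is a formal
    identity between l - r and x, or a nonzero multiple of x, which [module_coefs] reduces to
    scalars. *)
Lemma eq_difference (V : zmodType) (x l r : V) : l = r -> x = l - r -> x = 0.
Proof. by move=> -> ->; rewrite subrr. Qed.

Lemma scaler_cancel (k : fieldType) (V : lmodType k) (c : k) (x l r : V) :
  c != 0 -> l = r -> c *: x = l - r -> x = 0.
Proof.
by move=> /negbTE c0 -> /eqP; rewrite subrr scaler_eq0 c0 => /eqP.
Qed.

(** * Operators on the standard isotypic part *)

(* s, r and a stand for H_12, H_23 and a_12; in the last relation a_13 and a_23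
   are eliminated and s is moved past a. *)
Record generator_relations (k : fieldType) (V : lmodType k)
    (s r a : {linear V -> V}) : Prop := {
  gen_ss : forall z, s (s z) = z;
  gen_rr : forall z, r (r z) = z;
  gen_rsr : forall z, r (s (r z)) = s (r (s z));
  gen_sa : forall z, s (a z) = - a (s z);
  gen_aa : forall z, a (a z) = 0;
  gen_quad : forall z, a (s (r (a (r (s z))))) + s (r (a (s (r (a (s (r z)))))))
    - r (a (r (a z))) = z - s (r z) }.

Section Operators.

Variables (k : fieldType) (V : lmodType k) (s r a : {linear V -> V}).

Let sZ c z : s (c *: z) = c *: s z. Proof. exact: linearZ_LR. Qed.
Let sD y z : s (y + z) = s y + s z. Proof. exact: linearD. Qed.
Let sN z : s (- z) = - s z. Proof. exact: linearN. Qed.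
Let rZ c z : r (c *: z) = c *: r z. Proof. exact: linearZ_LR. Qed.
Let rD y z : r (y + z) = r y + r z. Proof. exact: linearD. Qed.
Let rN z : r (- z) = - r z. Proof. exact: linearN. Qed.
Let lin := (sZ, sD, sN, rZ, rD, rN).

Definition standard_v (n : V) := r n = n - s n.

(* The operators are locked to keep unification from unfolding them. *)
Definition pr_triv : {linear V -> V} := locked (
  6%:R^-1 \*: (idfun \+ s \+ r \+ (s \o r) \+ (r \o s) \+ (s \o r \o s)) : {linear V -> V}).

Lemma pr_trivE z : pr_triv z =
  6%:R^-1 *: (z + s z + r z + s (r z) + r (s z) + s (r (s z))).
Proof. by rewrite /pr_triv -lock. Qed.

Definition pr_sgn : {linear V -> V} := locked (
  6%:R^-1 \*: (idfun \- s \- r \+ (s \o r) \+ (r \o s) \- (s \o r \o s)) : {linear V -> V}).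

Lemma pr_sgnE z : pr_sgn z =
  6%:R^-1 *: (z - s z - r z + s (r z) + r (s z) - s (r (s z))).
Proof. by rewrite /pr_sgn -lock. Qed.

(** The diagonal matrix unit at v of the W_st block of the group algebra: 1/3 is dim W_st / |S_3|,
    and the coefficient of g is the v-coordinate of g^-1 v. *)
Definition pr_v : {linear V -> V} := locked (
  3%:R^-1 \*: (idfun \+ r \- (s \o r \o s) \- (r \o s)) : {linear V -> V}).

Lemma pr_vE z : pr_v z = 3%:R^-1 *: (z + r z - s (r (s z)) - r (s z)).
Proof. by rewrite /pr_v -lock. Qed.
(* For every z, the W_st-isotypic part of a z is
   (Tp z + s (Tp z)) + (Tm z - s (Tm z)). *)
Definition Tp : {linear V -> V} := locked (
  2%:R^-1 \*: (pr_v \o (a \+ (s \o a))) : {linear V -> V}).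

Lemma TpE z : Tp z = 2%:R^-1 *: pr_v (a z + s (a z)).
Proof. by rewrite /Tp -lock. Qed.

Definition Tm : {linear V -> V} := locked (
  2%:R^-1 \*: (pr_v \o (a \- (s \o a))) : {linear V -> V}).

Lemma TmE z : Tm z = 2%:R^-1 *: pr_v (a z - s (a z)).
Proof. by rewrite /Tm -lock. Qed.

Lemma standard_vD n n' : standard_v n -> standard_v n' -> standard_v (n + n').
Proof. by rewrite /standard_v !lin => -> ->; module_coefs k V; ring. Qed.

Lemma standard_vZ c n : standard_v n -> standard_v (c *: n).
Proof. by rewrite /standard_v !lin => ->; module_coefs k V; ring. Qed.

Hypotheses (n2 : 2%:R != 0 :> k) (n3 : 3%:R != 0 :> k).
Hypothesis gens : generator_relations s r a.
Let ss := gen_ss gens.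
Let rr := gen_rr gens.
Let rsr := gen_rsr gens.
Let sa := gen_sa gens.
Let aa := gen_aa gens.
Let quad := gen_quad gens.

Let n6 : 6%:R != 0 :> k.
Proof. by rewrite (natrM _ 2 3) mulf_neq0. Qed.

(** Applying r to r n = n - s n and using r^2 = 1 gives n = n - s n - r (s n). *)
Lemma standard_vs n : standard_v n -> r (s n) = - s n.
Proof.
move=> vn; have := rr n; rewrite {1}vn linearB vn => e.
transitivity (n - s n - (n - s n - r (s n))); last rewrite e;
  by module_coefs k V; ring.
Qed.

(** [pr_v] and its conjugate by s are the two diagonal matrix units of the W_st block; with the
    trivial and sign idempotents they sum to 1. *)
Lemma pr_decomposition z :
  z = pr_triv z + pr_sgn z + pr_v z + s (pr_v (s z)).
Proof.
rewrite pr_trivE pr_sgnE !pr_vE !lin !(ss, rsr).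
by module_coefs k V; field; rewrite ?n2 ?n3.
Qed.

Lemma pr_v_standard z : standard_v (pr_v z).
Proof.
rewrite /standard_v !pr_vE !lin !(ss, rr, rsr).
by module_coefs k V; ring.
Qed.

Lemma s_pr_triv z : s (pr_triv z) = pr_triv z.
Proof.
rewrite !pr_trivE !lin !(ss, rr, rsr).
by module_coefs k V; ring.
Qed.

Lemma r_pr_triv z : r (pr_triv z) = pr_triv z.
Proof.
rewrite !pr_trivE !lin !(ss, rr, rsr).
by module_coefs k V; ring.
Qed.

Lemma s_pr_sgn z : s (pr_sgn z) = - pr_sgn z.
Proof.
rewrite !pr_sgnE !lin !(ss, rr, rsr).
by module_coefs k V; ring.
Qed.

Lemma r_pr_sgn z : r (pr_sgn z) = - pr_sgn z.
Proof.
rewrite !pr_sgnE !lin !(ss, rr, rsr).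
by module_coefs k V; ring.
Qed.

Lemma pr_v_id n : standard_v n -> pr_v n = n.
Proof.
move=> vn; rewrite !pr_vE (standard_vs vn) vn !lin !ss.
by module_coefs k V; field.
Qed.

Lemma pr_v_s n : standard_v n -> pr_v (s n) = 0.
Proof.
move=> vn; rewrite !pr_vE (standard_vs vn) !ss vn !lin !ss.
by module_coefs k V; ring.
Qed.

Lemma pr_v_triv x : s x = x -> r x = x -> pr_v x = 0.
Proof.
move=> sx rx; rewrite !pr_vE !(sx, rx).
by module_coefs k V; ring.
Qed.

Lemma pr_v_sgn y : s y = - y -> r y = - y -> pr_v y = 0.
Proof.
move=> sy ry; rewrite !pr_vE !(sy, ry, lin).
by module_coefs k V; ring.
Qed.

Lemma pr_triv_v n : standard_v n -> pr_triv n = 0.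
Proof.
move=> vn; rewrite pr_trivE (standard_vs vn) vn !lin ?ss.
by module_coefs k V; ring.
Qed.

Lemma pr_sgn_v n : standard_v n -> pr_sgn n = 0.
Proof.
move=> vn; rewrite pr_sgnE (standard_vs vn) vn !lin ?ss.
by module_coefs k V; ring.
Qed.

Lemma pr_triv_s z : pr_triv (s z) = pr_triv z.
Proof.
rewrite !pr_trivE !ss; module_coefs k V; ring.
Qed.

Lemma pr_sgn_s z : pr_sgn (s z) = - pr_sgn z.
Proof.
rewrite !pr_sgnE !ss; module_coefs k V; ring.
Qed.

Lemma pr_triv_r z : pr_triv (r z) = pr_triv z.
Proof.
rewrite !pr_trivE !(rr, rsr, ss); module_coefs k V; ring.
Qed.

Lemma pr_sgn_r z : pr_sgn (r z) = - pr_sgn z.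
Proof.
rewrite !pr_sgnE !(rr, rsr, ss); module_coefs k V; ring.
Qed.

Let pvD y z : pr_v (y + z) = pr_v y + pr_v z. Proof. exact: linearD. Qed.
Let pvN z : pr_v (- z) = - pr_v z. Proof. exact: linearN. Qed.
Let pvZ c z : pr_v (c *: z) = c *: pr_v z. Proof. exact: linearZ_LR. Qed.
Let ptD y z : pr_triv (y + z) = pr_triv y + pr_triv z. Proof. exact: linearD. Qed.
Let ptN z : pr_triv (- z) = - pr_triv z. Proof. exact: linearN. Qed.
Let ptZ c z : pr_triv (c *: z) = c *: pr_triv z. Proof. exact: linearZ_LR. Qed.
Let psD y z : pr_sgn (y + z) = pr_sgn y + pr_sgn z. Proof. exact: linearD. Qed.
Let psN z : pr_sgn (- z) = - pr_sgn z. Proof. exact: linearN. Qed.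
Let psZ c z : pr_sgn (c *: z) = c *: pr_sgn z. Proof. exact: linearZ_LR. Qed.
Let linp := (pvD, pvN, pvZ, ptD, ptN, ptZ, psD, psN, psZ).

Lemma Tp_standard z : standard_v (Tp z).
Proof. by rewrite /standard_v TpE sZ rZ pr_v_standard scalerBr. Qed.

Lemma Tm_standard z : standard_v (Tm z).
Proof. by rewrite /standard_v TmE sZ rZ pr_v_standard scalerBr. Qed.

(** [Tp z + Tm z] is the [pr_v] part of a z and [Tp z - Tm z] that of s (a z), so this is
    [pr_decomposition] at a z. *)
Lemma a_decomposition z :
  a z = pr_triv (a z) + pr_sgn (a z) + (Tp z + s (Tp z)) + (Tm z - s (Tm z)).
Proof.
rewrite {1}[a z]pr_decomposition TpE TmE !linp !lin.
by module_coefs k V; field.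
Qed.

Let as_ z : a (s z) = - s (a z).
Proof. by rewrite sa opprK. Qed.

Let aZ c z : a (c *: z) = c *: a z. Proof. exact: linearZ_LR. Qed.
Let aD y z : a (y + z) = a y + a z. Proof. exact: linearD. Qed.
Let aN z : a (- z) = - a z. Proof. exact: linearN. Qed.
Let lina := (lin, aZ, aD, aN).

(** Since s a = - a s, the vector a y is fixed by s; hence it has no sign component, and its two
    standard components agree. *)
Lemma a_sgn y : s y = - y -> r y = - y ->
  a y = pr_triv (a y) + pr_v (a y) + s (pr_v (a y)).
Proof.
move=> sy ry; have say : s (a y) = a y by rewrite sa sy linearN opprK.
rewrite {1}[a y]pr_decomposition say.
have : pr_sgn (a y) = - pr_sgn (a y) by rewrite -pr_sgn_s say.
move/eqP; rewrite -subr_eq0 opprK -mulr2n -scaler_nat scaler_eq0 (negbTE n2).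
by move/eqP => ->; rewrite addr0.
Qed.

Let n9 : 9%:R != 0 :> k.
Proof. by rewrite (natrM _ 3 3) mulf_neq0. Qed.

(** With a y = g + d + s d, the relation a^2 y = 0 expresses a g through a d. The quadratic relation
    at y then involves only translates of a d, and its trivial and sign projections are 9 times the
    wanted components, up to sign. *)
Lemma quad_sgn y : s y = - y -> r y = - y ->
  pr_triv (a (pr_v (a y))) = 0 /\ pr_sgn (a (pr_v (a y))) = 0.
Proof.
move=> sy ry; move: (a_sgn sy ry) (pr_v_standard (a y)).
move: (s_pr_triv (a y)) (r_pr_triv (a y)).
move: (pr_triv (a y)) (pr_v (a y)) => g d sg rg ey sd.
have Q := quad y; have A := aa y.
rewrite ey !lina as_ in A.
rewrite !(sy, ry, lina, ey) in Q.
have ag : a g = s (a d) - a d.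
  transitivity (a g + a d - s (a d) + (s (a d) - a d)); last by rewrite A add0r.
  by module_coefs k V; ring.
rewrite !(sg, rg, standard_vs sd, sd, lina, as_, ag) in Q.
split.
  apply: (scaler_cancel n9 (congr1 pr_triv (esym Q))).
  rewrite !(linp, pr_triv_s, pr_triv_r).
  by module_coefs k V; ring.
apply: (scaler_cancel n9 (congr1 pr_sgn (esym Q))).
rewrite !(linp, pr_sgn_s, pr_sgn_r).
by module_coefs k V; ring.
Qed.

(* The two eigencomponents of [a (a z) = 0] for s. *)
Lemma a_a_decomposition z :
  a (pr_triv (a z)) = s (a (Tp z)) - a (Tp z) /\
  a (pr_sgn (a z)) = - (a (Tm z) + s (a (Tm z))).
Proof.
have := aa z; rewrite [in X in X -> _](a_decomposition z).
move: (pr_triv (a z)) (pr_sgn (a z)) (s_pr_triv (a z)) (s_pr_sgn (a z)).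
move: (Tp z) (Tm z) => p q x y sx sy; rewrite !lina !as_ => A.
have sax : s (a x) = - a x by rewrite sa sx.
have say : s (a y) = a y by rewrite sa sy aN opprK.
have B := congr1 s A; rewrite linear0 !lin sax say !ss in B.
split.
  (* Half the difference of A and its image B under s isolates the part where s acts by -1; half
     their sum, used for the second claim, isolates the fixed part. *)
  transitivity (2%:R^-1 *:
    (a x + a y + (a p - s (a p)) + (a q - - s (a q)) -
     (- a x + a y + (s (a p) - a p) + (s (a q) - - a q))) + (s (a p) - a p)).
    by module_coefs k V; field.
  by rewrite A B subrr scaler0 add0r.
transitivity (2%:R^-1 *:
    (a x + a y + (a p - s (a p)) + (a q - - s (a q)) +
     (- a x + a y + (s (a p) - a p) + (s (a q) - - a q))) - (a q + s (a q))).
  by module_coefs k V; field.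
by rewrite A B addr0 scaler0 add0r.
Qed.

(** By a^2 = 0 the composite T+ T- factors through the sign component of a z, which brings it within
    reach of [quad_sgn]. *)
Lemma Tp_Tm z : Tp (Tm z) = - 2%:R^-1 *: pr_v (a (pr_sgn (a z))).
Proof.
have [_ ->] := a_a_decomposition z.
by rewrite TpE !linp; module_coefs k V; field.
Qed.

Lemma a_Tp_Tm z : pr_triv (a (Tp (Tm z))) = 0 /\ pr_sgn (a (Tp (Tm z))) = 0.
Proof.
have [e1 e2] := quad_sgn (s_pr_sgn (a z)) (r_pr_sgn (a z)).
by rewrite Tp_Tm aZ !linp e1 e2 !scaler0.
Qed.

Lemma Tp_Tm_Tp_Tm z : Tp (Tm (Tp (Tm z))) = 0.
Proof. by rewrite Tp_Tm (a_Tp_Tm z).2 !linear0. Qed.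

(** The quadratic relation at n, expanded by [a_decomposition] at n, T+ n and T- n, becomes one
    equation in the W_st-isotypic part; its coordinates along v and w give the two claims. *)
Lemma Tp_Tm_quad n : standard_v n ->
  Tp (Tm n) + Tm (Tp n) = 0 /\ 9%:R *: Tp (Tp n) + Tm (Tm n) = - n.
Proof.
move=> sn; have Q := quad n; have [ax ay] := a_a_decomposition n.
have en := a_decomposition n.
move: (s_pr_triv (a n)) (r_pr_triv (a n)) (s_pr_sgn (a n)) (r_pr_sgn (a n)).
move: (Tp_standard n) (Tm_standard n) ax ay en.
move: (pr_triv (a n)) (pr_sgn (a n)) => x y sp sq ax ay en sx rx sy ry.
have ep := a_decomposition (Tp n); have eq := a_decomposition (Tm n).
move: (Tp_standard (Tp n)) (Tm_standard (Tp n)).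
move: (Tp_standard (Tm n)) (Tm_standard (Tm n)) ep eq sp sq ax ay en.
move: (Tp (Tp n)) (Tm (Tp n)) (Tp (Tm n)) (Tm (Tm n)) => pp mp pm mm.
move: (Tp n) (Tm n) => p q spm smm ep eq sp sq ax ay en spp smp.
rewrite !(standard_vs sn, sn, as_, lina, en) in Q.
rewrite !(standard_vs sp, standard_vs sq, sp, sq, sx, rx, sy, ry,
  as_, lina, ax, ay, ss) in Q.
(* The vectors a x and a y have been eliminated through a^2 = 0, so only a p and a q are left. *)
have {x y sx sy rx ry ax ay en}Q :
    - 3%:R *: a p + (2%:R *: s (a q) + a q) + 6%:R *: s (r (a p))
    - 3%:R *: r (s (a p)) - (r (s (a q)) + 2%:R *: r (a q)) - 2%:R *: n + s n = 0.
  by apply: (eq_difference Q); module_coefs k V; ring.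
move: (s_pr_triv (a p)) (r_pr_triv (a p)) (s_pr_sgn (a p)) (r_pr_sgn (a p)).
move: (s_pr_triv (a q)) (r_pr_triv (a q)) (s_pr_sgn (a q)) (r_pr_sgn (a q)).
move: (pr_triv (a p)) (pr_sgn (a p)) (pr_triv (a q)) (pr_sgn (a q)) ep eq.
move=> xp yp xq yq ep eq sxq rxq syq ryq sxp rxp syp ryp; rewrite !(ep, eq) in Q.
rewrite !(sxp, rxp, syp, ryp, sxq, rxq, syq, ryq, spp, spm, smp, smm, standard_vs spp,
  standard_vs spm, standard_vs smp, standard_vs smm, lin, ss) in Q.
(* The trivial and sign components have cancelled. The rest is a standard vector plus s of another
   one, and applying [pr_v] before and after s separates the two. *)
have {}Q : - 2%:R *: (9%:R *: pp + mm + n)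
    + s (9%:R *: pp + 9%:R *: (pm + mp) + mm + n) = 0.
  by apply: (eq_difference Q); rewrite !lin; module_coefs k V; ring.
have s1 : standard_v (9%:R *: pp + mm + n).
  by do !apply: standard_vD => //; apply: standard_vZ.
have s2 : standard_v (9%:R *: pp + 9%:R *: (pm + mp) + mm + n).
  by do !apply: standard_vD => //; apply: standard_vZ => //; apply: standard_vD.
have E1 := congr1 pr_v Q; rewrite linear0 pvD pvZ pr_v_id // pr_v_s // addr0 in E1.
have E2 := congr1 (fun z => pr_v (s z)) Q.
rewrite !linear0 sD pvD sZ pvZ pr_v_s // ss pr_v_id // scaler0 add0r in E2.
have {}E1 : 9%:R *: pp + mm + n = 0.
  by apply: (scaler_cancel n2 (esym E1)); module_coefs k V; ring.
split; last by apply/eqP; rewrite -addr_eq0 E1.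
apply: (scaler_cancel n9 (etrans E2 (esym E1))); module_coefs k V; ring.
Qed.

(** Anticommutation gives T+^2 T-^2 = - T+ T- T+ T- = 0, so 9 T+^2 + T-^2 = -1 at T-^2 n leaves only
    powers of T-. *)
Lemma Tm4 n : standard_v n -> Tm (Tm (Tm (Tm n))) = - Tm (Tm n).
Proof.
move=> sn; have [_ E] := Tp_Tm_quad (Tm_standard (Tm n)).
have [F _] := Tp_Tm_quad (Tm_standard n).
have {}F : Tp (Tm (Tm n)) = - Tm (Tp (Tm n)) by apply/eqP; rewrite -addr_eq0 F.
by rewrite F [Tp (- _)]linearN Tp_Tm_Tp_Tm oppr0 scaler0 add0r in E.
Qed.

(** With x, -2i y and u for the trivial component, the sign component and [Tp n], these are the
    formulas for a_12 on x, y and u in P. *)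
Lemma eigen_action (i : k) n : i ^+ 2 = - 1 -> standard_v n -> Tm n = i *: n ->
  [/\ a (pr_triv (a n)) = (2%:R * i) *: (Tp n - s (Tp n)),
      a (pr_sgn (a n)) = - (2%:R * i) *: (pr_triv (a n) + Tp n + s (Tp n)) &
      a (Tp n) = - i *: (Tp n - s (Tp n))].
Proof.
move=> i2 sn En; have [ax ay] := a_a_decomposition n.
have [E F] := Tp_Tm_quad sn; have [G1 G2] := a_Tp_Tm n.
have i0 : i != 0.
  by apply: contra_eq_neq i2 => ->; rewrite expr0n eq_sym oppr_eq0 oner_neq0.
rewrite En !linearZ_LR /= in E F G1 G2.
move/eqP: G1; rewrite scaler_eq0 (negbTE i0) => /eqP G1.
move/eqP: G2; rewrite scaler_eq0 (negbTE i0) => /eqP G2.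
(* T-^2 n = - n, so the relation 9 T+^2 + T-^2 = -1 leaves 9 T+^2 n = 0. *)
have F' : Tp (Tp n) = 0.
  apply: (scaler_cancel n9 F); rewrite En; module_coefs k V; ring: i2.
have E' : Tm (Tp n) = - i *: Tp n.
  apply/eqP; rewrite -subr_eq0 -E; apply/eqP; module_coefs k V; ring.
have ap : a (Tp n) = - i *: (Tp n - s (Tp n)).
  rewrite a_decomposition G1 G2 F' E' !lin linear0; module_coefs k V; ring.
split=> //; first by rewrite ax ap !lin !ss; module_coefs k V; ring.
rewrite ay En aZ [X in _ *: X + _]a_decomposition [X in s (_ *: X)]a_decomposition En.
rewrite !(lin, ss, s_pr_triv, s_pr_sgn); module_coefs k V; ring: i2.
Qed.

(** On standard vectors T- is a root of X^2 (X - i)(X + i) by [Tm4]. The operator applied to m is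
    (i/2) X^2 (X + i) at X = T-: it is annihilated by X - i and takes the value 1 at X = i. *)
Lemma eigen_projection (i : k) m : i ^+ 2 = -1 -> standard_v m ->
  let n := - 2%:R^-1 *: (Tm (Tm m) - i *: Tm (Tm (Tm m))) in
  standard_v n /\ Tm n = i *: n.
Proof.
move=> i2 sm n; split.
  rewrite /n /standard_v !lin !(Tm_standard _).
  by module_coefs k V; ring.
rewrite /n [LHS]linearZ_LR [Tm (_ + _)]linearD [Tm (- _)]linearN [Tm (i *: _)]linearZ_LR
  (Tm4 sm).
by module_coefs k V; ring: i2.
Qed.

(** Serves to read the components off an explicit formula for a n: each projection kills all the
    terms but its own. *)
Lemma decomposition_unique n x y p q :
  s x = x -> r x = x -> s y = - y -> r y = - y -> standard_v p -> standard_v q ->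
  a n = x + y + (p + s p) + (q - s q) ->
  [/\ pr_triv (a n) = x, pr_sgn (a n) = y, Tp n = p & Tm n = q].
Proof.
move=> sx rx sy ry sp sq an; split.
- rewrite an !linp !pr_triv_s (pr_triv_v sp) (pr_triv_v sq)
    !pr_trivE !(sx, rx, sy, ry, lin).
  by module_coefs k V; field.
- rewrite an !linp !pr_sgn_s (pr_sgn_v sp) (pr_sgn_v sq) !pr_sgnE !(sx, rx, sy, ry, lin).
  by module_coefs k V; field.
- rewrite TpE an !(sx, sy, lin, linp, ss) (pr_v_triv sx rx) (pr_v_sgn sy ry)
    (pr_v_s sp) (pr_v_s sq) (pr_v_id sp) (pr_v_id sq).
  by module_coefs k V; field.
- rewrite TmE an !(sx, sy, lin, linp, ss) (pr_v_triv sx rx) (pr_v_sgn sy ry)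
    (pr_v_s sp) (pr_v_s sq) (pr_v_id sp) (pr_v_id sq).
  by module_coefs k V; field.
Qed.

End Operators.

(** * Naturality of the projections and of T+ and T- *)

Section Intertwining.

Variables (k : fieldType) (V W : lmodType k).
Variables (s r a : {linear V -> V}) (s' r' a' : {linear W -> W}).
Variable f : {linear V -> W}.
Hypotheses (fs : forall z, f (s z) = s' (f z)) (fr : forall z, f (r z) = r' (f z))
  (fa : forall z, f (a z) = a' (f z)).

Lemma intertwine_triv z : f (pr_triv s r z) = pr_triv s' r' (f z).
Proof.
by rewrite !pr_trivE linearZ_LR !(linearD f) !(fr, fs).
Qed.

Lemma intertwine_sgn z : f (pr_sgn s r z) = pr_sgn s' r' (f z).
Proof.
by rewrite !pr_sgnE linearZ_LR !(linearD f, linearN f) !(fr, fs).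
Qed.

Lemma intertwine_v z : f (pr_v s r z) = pr_v s' r' (f z).
Proof.
by rewrite !pr_vE linearZ_LR !(linearD f, linearN f) !(fr, fs).
Qed.

Lemma intertwine_Tp z : f (Tp s r a z) = Tp s' r' a' (f z).
Proof.
by rewrite !TpE linearZ_LR intertwine_v !(linearD f) !(fs, fa).
Qed.

Lemma intertwine_Tm z : f (Tm s r a z) = Tm s' r' a' (f z).
Proof.
by rewrite !TmE linearZ_LR intertwine_v !(linearD f, linearN f) !(fs, fa).
Qed.

End Intertwining.

(** * Modules and homomorphisms in terms of generators *)

Section Generation.

Variable k : fieldType.

Lemma transpJ23_t12 : transpJ (val t23) t12 = t13.
Proof. by apply: val_inj; rewrite /= tpermJ tpermL tpermD. Qed.

Lemma transpJ13_t12 : transpJ (val t13) t12 = t23.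
Proof. by apply: val_inj; rewrite /= tpermJ tpermL tpermD // tpermC. Qed.

Lemma transpJ_self (s : transp) : transpJ (val s) s = s.
Proof. by apply: val_inj; rewrite /= conjgE mulgA mulVg mul1g. Qed.

Lemma transp_mulK (s : transp) : (val s * val s = 1)%g.
Proof. by case: (transpP s) => ->; exact: tperm2. Qed.

Lemma t13_mul : (val t13 = val t12 * (val t23 * val t12))%g.
Proof.
have -> : val t13 = (val t23 ^ val t12)%g by rewrite /= tpermJ tpermR tpermD.
by rewrite conjgE /= tpermV mulgA.
Qed.

Section Action.

Variables (V : lmodType k) (H : 'S_3 -> {linear V -> V}).
Hypothesis H_action : s3_action H.

Lemma action_t13 z : H (val t13) z = H (val t12) (H (val t23) (H (val t12) z)).
Proof. by rewrite !H_action.2 t13_mul. Qed.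

Lemma action_transpK (s : transp) z : H (val s) (H (val s) z) = z.
Proof. by rewrite H_action.2 transp_mulK H_action.1. Qed.

Lemma action_braid z : H (val t23) (H (val t12) (H (val t23) z)) =
  H (val t12) (H (val t23) (H (val t12) z)).
Proof.
rewrite -action_t13 !H_action.2; congr (H _ z).
have -> : val t13 = (val t12 ^ val t23)%g.
  by rewrite -[RHS]/(val (transpJ _ _)) transpJ23_t12.
by rewrite conjgE /= tpermV mulgA.
Qed.

(** If c is the chosen conjugator of (12)^t, then t c^-1 centralizes (12), so t is c or (12) c; and
    c is 1, (23) or (13) = (12)(23)(12). *)
Lemma action_ind (Q : 'S_3 -> Prop) : Q 1%g ->
  (forall t, Q t -> Q (t * val t12)%g) -> (forall t, Q t -> Q (t * val t23)%g) ->
  forall t, Q t.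
Proof.
move=> Q1 Q12 Q23 t.
have Q_12 : Q (val t12) by rewrite -[val t12]mul1g; apply: Q12.
have Q13 u : Q u -> Q (u * val t13)%g.
  by move=> Qu; rewrite t13_mul !mulgA; apply/Q12/Q23/Q12.
pose c := transp_conjugator (transpJ t t12).
have : (val t12 ^ (t * c^-1) = val t12)%g.
  by rewrite conjgM -[(val t12 ^ t)%g]/(val (transpJ t t12)) -transp_conjugatorP
    -/c -conjgM mulgV conjg1.
have Qc u : Q u -> Q (u * c)%g.
  rewrite /c /transp_conjugator.
  by case: ifP => _; [rewrite mulg1|case: ifP => _; [apply: Q23|apply: Q13]].
case/cent_t12 => E; rewrite -[t](mulgKV c) E; exact: Qc.
Qed.

End Action.

Lemma relations_generators (V : lmodType k) (H : 'S_3 -> {linear V -> V}) a :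
  a1_relations H a -> generator_relations (H (val t12)) (H (val t23)) (a t12).
Proof.
move=> [HA Ha Hsqr Hquad].
have sa z : H (val t12) (a t12 z) = - a t12 (H (val t12) z).
  by rewrite Ha sgn_transp transpJ_self scaleN1r.
split=> //.
- exact: action_transpK.
- exact: action_transpK.
- exact: action_braid.
move=> z; rewrite -Hquad.
have a13E u : a t13 u = - H (val t23) (a t12 (H (val t23) u)).
  by rewrite Ha sgn_transp transpJ23_t12 scaleN1r opprK action_transpK.
have a23E u : a t23 u = - H (val t13) (a t12 (H (val t13) u)).
  by rewrite Ha sgn_transp transpJ13_t12 scaleN1r opprK action_transpK.
rewrite !a13E !a23E !(action_t13 HA).
move: (action_transpK HA t12) (action_transpK HA t23) (action_braid HA) sa.
move: (H (val t12)) (H (val t23)) (a t12) => s r b ss rr rsr sb.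
rewrite !(linearN s, linearN b, linearN r) !sb !(linearN s, linearN b, linearN r).
by rewrite !(ss, rsr) !sb !(linearN b, linearN r, linearN s) !opprK.
Qed.

Lemma generators_action (V : lmodType k) (H : 'S_3 -> {linear V -> V})
    (a : {linear V -> V}) :
  s3_action H -> generator_relations (H (val t12)) (H (val t23)) a ->
  exists act : a1_action V,
    (forall t z, actH act t z = H t z) /\ forall z, acta act t12 z = a z.
Proof.
move=> HA G.
have A_quad z : let a13 v := - H (val t23) (a (H (val t23) v)) in
    let a23 v := - H (val t13) (a (H (val t13) v)) in
    a (a23 z) + a23 (a13 z) + a13 (a z) = z - H (val t12) (H (val t23) z).
  move=> /=; rewrite !(action_t13 HA) -(gen_quad G).
  case: G; move: (H (val t12)) (H (val t23)) => s r ss rr rsr sa _ _.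
  rewrite !(linearN s, linearN a, linearN r) !sa !(linearN s, linearN a, linearN r).
  by rewrite !(ss, rsr) !sa !(linearN a, linearN r, linearN s) !opprK.
exists (action_of_a12 HA (gen_sa G) (gen_aa G) A_quad); split=> // z.
rewrite /= /a_of_a12 /transp_conjugator eqxx /= /sgn odd_perm1 scale1r.
by rewrite invg1 !HA.1.
Qed.

End Generation.

(** * Homomorphisms, and uniqueness and transport of projective covers *)

Section ModuleTheory.

Variable k : fieldType.
Implicit Types M N P S : a1_module k.

Local Notation s12 M := (mH M (val t12)).
Local Notation s23 M := (mH M (val t23)).
Local Notation a12 M := (ma M t12).

Lemma module_generators M : generator_relations (s12 M) (s23 M) (a12 M).
Proof. exact: relations_generators (actP (a1_act M)). Qed.

Lemma hom_generators M N (f : {linear M -> N}) :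
  (forall z, f (s12 M z) = s12 N (f z)) -> (forall z, f (s23 M z) = s23 N (f z)) ->
  (forall z, f (a12 M z) = a12 N (f z)) -> a1_hom f.
Proof.
move=> f12 f23 fa; case: (actP (a1_act M)) (actP (a1_act N)) => HM aM _ _ [HN aN _ _].
rewrite -/(mH _) -/(ma _) in HM aM HN aN.
have fH t z : f (mH M t z) = mH N t (f z).
  elim/action_ind: t z => [z|t IH z|t IH z]; first by rewrite HM.1 HN.1.
  - by rewrite -HM.2 f12 IH HN.2.
  - by rewrite -HM.2 f23 IH HN.2.
(* Each a_s is sgn(c) H_c a_12 H_c^-1 with c conjugating (12) to s, so compatibility with a_12 and
   all H_t suffices. *)
split=> // s z; pose c := transp_conjugator s.
have -> : s = transpJ c t12 by apply: val_inj; rewrite /= -[LHS]transp_conjugatorP.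
have cK (K : 'S_3 -> {linear M -> M}) : s3_action K -> K c (K c^-1%g z) = z.
  by case=> K1 KM; rewrite KM mulVg K1.
rewrite -[z](cK (mH M)) //.
have sM u : ma M (transpJ c t12) (mH M c u) = sgn k c *: mH M c (a12 M u).
  by rewrite aM scalerA -expr2 sqrr_sign scale1r.
have sN u : ma N (transpJ c t12) (mH N c u) = sgn k c *: mH N c (a12 N u).
  by rewrite aN scalerA -expr2 sqrr_sign scale1r.
by rewrite sM linearZ_LR fH fa -sN -fH.
Qed.

(** Lift f through g to h. The image of h maps onto S, so h is surjective as g is essential. A
    section e of h satisfies f e = g, so its image also maps onto S and e is surjective; hence h and
    e are mutually inverse. *)
Lemma proj_cover_isom P Q S :
  is_projective_cover P S -> is_projective_cover Q S -> a1_isom P Q.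
Proof.
move=> [Pproj [f fhom [fsurj fess]]] [Qproj [g ghom [gsurj gess]]].
have [h hhom hE] := Pproj _ _ g f ghom gsurj fhom.
have im_sub M N (e : {linear M -> N}) : a1_hom e ->
    a1_submodule (fun y : N => exists x, e x = y).
  case=> eH ea; split.
  - by exists 0; rewrite linear0.
  - by move=> _ _ [x <-] [y <-]; exists (x + y); rewrite linearD.
  - by move=> c _ [x <-]; exists (c *: x); rewrite linearZ_LR.
  - by move=> t _ [x <-]; exists (mH M t x); rewrite eH.
  - by move=> t _ [x <-]; exists (ma M t x); rewrite ea.
have hsurj : surjective h.
  apply: gess (im_sub _ _ _ hhom) _ => y; have [x <-] := fsurj y.
  by exists (h x) => //; exists x.
have idhom : a1_hom (idfun : {linear Q -> Q}) by [].
have [e ehom eE] := Qproj _ _ h idfun hhom hsurj idhom.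
have esurj : surjective e.
  apply: fess (im_sub _ _ _ ehom) _ => y; have [x <-] := gsurj y.
  by exists (e x); [exists x | rewrite -hE eE].
exists h => //; exists e => x; last exact: eE.
by have [y <-] := esurj x; rewrite eE.
Qed.

Lemma isom_projective_coverP S P : is_projective_cover P S -> isom_projective_cover S P.
Proof. by move=> PS; split=> [|Q QS]; [exists P | exact: proj_cover_isom QS PS]. Qed.

Lemma hom_comp M N P (f : {linear M -> N}) (g : {linear N -> P}) :
  a1_hom f -> a1_hom g -> a1_hom (g \o f).
Proof. by move=> [fH fa] [gH ga]; split=> t v /=; rewrite ?fH ?fa ?gH ?ga. Qed.

Lemma isom_inverse M N : a1_isom M N ->
  exists f : {linear M -> N}, exists g : {linear N -> M},
  [/\ a1_hom f, a1_hom g, cancel f g & cancel g f].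
Proof.
case=> f fhom [g fK gK].
pose gM := GRing.isLinear.Build k N M _ g (can2_linear fK gK).
pose gL : {linear N -> M} := HB.pack g gM.
exists f, gL; split=> //; case: fhom => fH fa.
by split=> t v /=; apply: (can_inj fK); rewrite ?fH ?fa !gK.
Qed.

Lemma isom_sym M N : a1_isom M N -> a1_isom N M.
Proof. by case/isom_inverse=> f [g [_ ghom fK gK]]; exists g => //; exists f. Qed.

Lemma submodule_preim M N (f : {linear M -> N}) (U : N -> Prop) :
  a1_hom f -> a1_submodule U -> a1_submodule (fun x => U (f x)).
Proof.
move=> [fH fa] [U0 UD UZ UH Ua]; split=> [|v w|c v|t v|t v].
- by rewrite linear0.
- by rewrite linearD; apply: UD.
- by rewrite linearZ_LR; apply: UZ.
- by rewrite fH; apply: UH.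
- by rewrite fa; apply: Ua.
Qed.

Lemma proj_cover_transport P Q S T :
  a1_isom P Q -> a1_isom S T -> is_projective_cover P S -> is_projective_cover Q T.
Proof.
move=> /isom_inverse[p [q [phom qhom pK qK]]] /isom_inverse[e [d [ehom _ eK dK]]].
move=> [Pproj [f fhom [fsurj fess]]]; split.
  move=> M N g h ghom gsurj hhom.
  have [l lhom lE] := Pproj M N g (h \o p) ghom gsurj (hom_comp phom hhom).
  exists (l \o q); first exact: hom_comp.
  by move=> v /=; rewrite lE /= qK.
exists (e \o f \o q); first exact: hom_comp qhom (hom_comp fhom ehom).
split=> [y|U Usub Usurj x].
  have [x fx] := fsurj (d y); exists (p x) => /=.
  by rewrite pK fx dK.
rewrite -[x]qK; apply: (fess _ (submodule_preim phom Usub)) => y.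
have [z Uz /= zE] := Usurj (e y); exists (q z); first by rewrite qK.
by apply: (can_inj eK).
Qed.

End ModuleTheory.

Import VectorInternalTheory.

(** * Twisting by signs *)

Section Twist.

Variables (k : fieldType) (b c : bool).
Implicit Types M N P S : a1_module k.

Section TwistModule.

Variable M : a1_module k.

Definition twist_H (t : 'S_3) : {linear M -> M} := (sgn k t ^+ b) \*: mH M t.
Definition twist_a (s : transp) : {linear M -> M} := ((-1) ^+ c) \*: ma M s.

Lemma twist_HE t z : twist_H t z = sgn k t ^+ b *: mH M t z.
Proof. by []. Qed.

Lemma twist_aE s z : twist_a s z = (-1) ^+ c *: ma M s z.
Proof. by []. Qed.

(** The quadratic relation is homogeneous of degree two in the a_s and contains H only through a
    product of two transpositions, so the signs cancel there; both sides of the commutation relation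
    change by the same sign. *)
Lemma twist_relations : a1_relations twist_H twist_a.
Proof.
case: (actP (a1_act M)); rewrite -/(mH _) -/(ma _) => -[H1 HM] aM aa quad.
have c2 : (-1) ^+ c * (-1) ^+ c = 1 :> k by rewrite -expr2 sqrr_sign.
split.
- split=> [v|s t v]; rewrite !twist_HE.
    by rewrite /sgn odd_perm1 expr1n scale1r.
  by rewrite (linearZ_LR (mH M t)) scalerA HM sgnM exprMn mulrC.
- move=> t s v; rewrite !twist_HE !twist_aE.
  by rewrite (linearZ_LR (mH M t)) (linearZ_LR (ma M _)) aM !scalerA; congr (_ *: _); ring.
- by move=> v; rewrite !twist_aE (linearZ_LR (ma M _)) aa !scaler0.
move=> v; rewrite !twist_aE !twist_HE.
rewrite !(linearZ_LR (ma M _)) (linearZ_LR (mH M _)) !scalerA c2 !scale1r quad.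
by rewrite !sgn_transp -exprD addnn -mul2n exprM sqrrN expr1n expr1n scale1r.
Qed.

Definition twist : a1_module k := A1Module (A1Action twist_relations).

End TwistModule.

Lemma twist_mH M t (v : M) : mH (twist M) t v = sgn k t ^+ b *: mH M t v.
Proof. by []. Qed.

Lemma twist_ma M s (v : M) : ma (twist M) s v = (-1) ^+ c *: ma M s v.
Proof. by []. Qed.

Lemma sgn_pow2 t : sgn k t ^+ b * sgn k t ^+ b = 1.
Proof. by rewrite -exprMn -expr2 sqrr_sign expr1n. Qed.

Lemma sign_pow2 : (-1) ^+ c * (-1) ^+ c = 1 :> k.
Proof. by rewrite -expr2 sqrr_sign. Qed.

Lemma mH_twist M t (v : M) : mH M t v = sgn k t ^+ b *: mH (twist M) t v.
Proof. by rewrite twist_mH scalerA sgn_pow2 scale1r. Qed.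

Lemma ma_twist M s (v : M) : ma M s v = (-1) ^+ c *: ma (twist M) s v.
Proof. by rewrite twist_ma scalerA sign_pow2 scale1r. Qed.

Lemma twist_hom M N (f : {linear M -> N}) :
  a1_hom f -> a1_hom (f : {linear twist M -> twist N}).
Proof.
case=> fH fa; split=> t v.
  by rewrite twist_mH (linearZ_LR f) fH -twist_mH.
by rewrite twist_ma (linearZ_LR f) fa -twist_ma.
Qed.

Lemma twist_homl M N (f : {linear M -> N}) :
  a1_hom (f : {linear twist M -> N}) -> a1_hom (f : {linear M -> twist N}).
Proof.
case=> fH fa; split=> t v.
  by rewrite mH_twist (linearZ_LR f) fH twist_mH.
by rewrite ma_twist (linearZ_LR f) fa twist_ma.
Qed.

Lemma twist_homr M N (f : {linear M -> N}) :
  a1_hom (f : {linear M -> twist N}) -> a1_hom (f : {linear twist M -> N}).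
Proof.
case=> fH fa; split=> t v.
  by rewrite twist_mH (linearZ_LR f) fH [RHS]mH_twist.
by rewrite twist_ma (linearZ_LR f) fa [RHS]ma_twist.
Qed.

Lemma twist_isom M N : a1_isom (twist M) N -> a1_isom (twist N) M.
Proof.
case=> f fhom fbij; apply: isom_sym.
by exists (f : {linear M -> twist N}); first exact: twist_homl.
Qed.

Lemma twist_submodule M (U : M -> Prop) :
  a1_submodule (U : twist M -> Prop) -> a1_submodule U.
Proof.
case=> U0 UD UZ UH Ua; split=> // t v Uv.
  by rewrite mH_twist; exact/UZ/UH.
by rewrite ma_twist; exact/UZ/Ua.
Qed.

(** Twisting keeps the underlying spaces and is its own inverse: a lifting problem for [twist P]
    along M -> N is one for P along [twist M] -> [twist N], and submodules are the same. *)
Lemma proj_cover_twist P S :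
  is_projective_cover P S -> is_projective_cover (twist P) (twist S).
Proof.
move=> [Pproj [f fhom [fsurj fess]]]; split; last first.
  exists (f : {linear twist P -> twist S}); first exact: twist_hom.
  by split=> // U /twist_submodule; apply: fess.
move=> M N g h ghom gsurj hhom.
have [e ehom eE] := Pproj (twist M) (twist N) g h (twist_hom ghom) gsurj
  (twist_homl hhom).
by exists e => //; apply: twist_homr.
Qed.

End Twist.

(** * Tensoring with the sign module as a sign twist *)

Section TensorSign.

Variable k : fieldType.
Variable P : fd_a1_module k.

Let one : k^o := 1.

Lemma vec_e_sum (U : vectType k) (u : U) :
  u = \sum_i v2r u 0 i *: vec_e i.
Proof.
apply: (can_inj v2rK); rewrite linear_sum [LHS]row_sum_delta.
by apply: eq_bigr => i _; rewrite linearZ /= r2vK.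
Qed.

(** The inverse contracts the factor k^o: the coordinate vector [vec_e j] of k^o is itself a scalar,
    though not necessarily 1, and multiplies [vec_e i]. *)
Lemma pure_one_bij : bijective (fun z : P => pure z one).
Proof.
exists (fun X : tens P k^o => \sum_i \sum_j (X i j * (vec_e j : k^o)) *: vec_e i) => [z|X].
  rewrite [RHS]vec_e_sum; apply: eq_bigr => i _; rewrite -scaler_suml; congr (_ *: _).
  rewrite -[RHS]mulr1 -[in RHS]/(one : k) [in RHS](vec_e_sum one) mulr_sumr.
  by apply: eq_bigr => j _; rewrite mxE big_ord1 mxE mulrA.
rewrite [RHS]tens_sum -/(pure_l one _) linear_sum; apply: eq_bigr => i _.
rewrite linear_sum; apply: eq_bigr => j _; rewrite -scalerA linearZ_LR; congr (_ *: _).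
have -> : vec_e j = (vec_e j : k) *: one by rewrite [RHS]mulr1.
by rewrite [RHS]linearZ_LR [LHS]linearZ_LR [_ *: one]mulr1.
Qed.

Lemma one_pure_bij : bijective (fun z : P => pure one z).
Proof.
exists (fun X : tens k^o P => \sum_i \sum_j (X i j * (vec_e i : k^o)) *: vec_e j) => [z|X].
  rewrite exchange_big [RHS]vec_e_sum; apply: eq_bigr => j _.
  rewrite -scaler_suml; congr (_ *: _).
  rewrite -[RHS]mul1r -[in RHS]/(one : k) [in RHS](vec_e_sum one) mulr_suml.
  by apply: eq_bigr => i _; rewrite mxE big_ord1 mxE mulrAC.
rewrite [RHS]tens_sum linear_sum; apply: eq_bigr => i _.
rewrite linear_sum; apply: eq_bigr => j _; rewrite -scalerA linearZ_LR; congr (_ *: _).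
have -> : vec_e i = (vec_e i : k) *: one by rewrite [RHS]mulr1.
by rewrite pureZl [LHS]linearZ_LR [_ *: one]mulr1.
Qed.

Lemma tens_mH (M N : fd_a1_module k) t (m : M) (n : N) :
  mH (tens_module M N) t (pure m n) = pure (mH M t m) (mH N t n).
Proof. exact: tens_H_pure. Qed.

Lemma tens_ma (M N : fd_a1_module k) s (m : M) (n : N) :
  ma (tens_module M N) s (pure m n)
  = pure (mH M (val s) m) (ma N s n) + pure (ma M s m) n.
Proof. exact: tens_a_pure. Qed.

(** On z (x) 1 the summand H_s (x) a_s vanishes and a_s (x) 1 acts without a sign, so only the H_t
    are twisted. *)
Lemma tens_sgn_isom : a1_isom (twist true false P) (tens_module P (S_sgn k)).
Proof.
exists (pure_l one : {linear P -> tens P k^o}); last exact: pure_one_bij.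
split=> t v.
  rewrite twist_mH expr1 linearZ_LR [RHS]tens_mH.
  by rewrite -[mH (S_sgn k) t one]/(sgn k t *: one) linearZ_LR.
rewrite twist_ma expr0 scale1r [RHS]tens_ma.
by rewrite -[ma (S_sgn k) t one]/(0 : k^o) linear0 add0r.
Qed.

(** On 1 (x) z only H_s (x) a_s survives, and H_s contributes sgn(s) = -1, so the a_s change sign as
    well. *)
Lemma sgn_tens_isom : a1_isom (twist true true P) (tens_module (S_sgn k) P).
Proof.
exists (pure one : {linear P -> tens k^o P}); last exact: one_pure_bij.
split=> t v.
  rewrite twist_mH expr1 linearZ_LR [RHS]tens_mH.
  by rewrite -[mH (S_sgn k) t one]/(sgn k t *: one) pureZl.
rewrite twist_ma expr1 linearZ_LR [RHS]tens_ma.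
rewrite -[mH (S_sgn k) (val t) one]/(sgn k (val t) *: one) sgn_transp pureZl.
rewrite -[ma (S_sgn k) t one]/(0 : k^o) -(scale0r (0 : k^o)) pureZl scale0r.
by rewrite addr0.
Qed.

End TensorSign.

(** * The simple modules *)

Section Standard.

Variable k : fieldType.

Section StMap.

Variables (V : lmodType k) (p q : V).

Definition st_map_fun (z : 'rV[k]_2) : V := z 0 0 *: p + z 0 1 *: q.

Fact st_map_linear : linear st_map_fun.
Proof.
move=> c z z'; rewrite /st_map_fun !mxE.
by module_coefs k V; ring.
Qed.

HB.instance Definition _ :=
  GRing.isLinear.Build k 'rV[k]_2 V _ st_map_fun st_map_linear.

Definition st_map : {linear 'rV[k]_2 -> V} := st_map_fun.

Lemma st_map_v : st_map (st_v k) = p.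
Proof. by rewrite /= /st_map_fun !mxE /= scale1r scale0r addr0. Qed.

Lemma st_map_w : st_map (st_w k) = q.
Proof. by rewrite /= /st_map_fun !mxE /= scale1r scale0r add0r. Qed.

Lemma st_ext (f g : {linear 'rV[k]_2 -> V}) :
  f (st_v k) = g (st_v k) -> f (st_w k) = g (st_w k) -> f =1 g.
Proof.
move=> ev ew z; rewrite (st_coord z) (linearD f) (linearD g).
by rewrite !(linearZ_LR f) !(linearZ_LR g) ev ew.
Qed.

End StMap.

Lemma st_v_neq0 : st_v k != 0.
Proof.
by apply/eqP => /rowP/(_ 0)/eqP; rewrite !mxE /= oner_eq0.
Qed.

Lemma S_st_a12 (theta : k) (h : st_param theta) (z : 'rV[k]_2) :
  ma (S_st theta h) t12 z = st_a12 theta z.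
Proof.
rewrite -[LHS]/(a_of_a12 _ _ _ _) /a_of_a12 /transp_conjugator eqxx /=.
rewrite /sgn odd_perm1 scale1r.
by rewrite invg1 -![_ *m st_mx k 1%g]/(st_H k 1%g _) !(st_action k).1.
Qed.

Lemma S_st_H (theta : k) (h : st_param theta) t (z : 'rV[k]_2) :
  mH (S_st theta h) t z = st_H k t z.
Proof. by []. Qed.

Hypotheses (n2 : 2%:R != 0 :> k) (n3 : 3%:R != 0 :> k).

(** In W_st (x) sgn the canonical basis is v' = v - 2w, w' = 2v - w. Since v' + w' = 3 (v - w), one
    gets a_12 v' = - (theta / 3) (v' + w') before the sign (-1)^c is applied. *)
Lemma st_twist_sgn_isom (c : bool) (theta theta' : k)
    (h : st_param theta) (h' : st_param theta') :
  theta ^+ 2 = -1 -> 3%:R * theta' = - (-1) ^+ c * theta ->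
  a1_isom (twist true c (S_st theta h)) (S_st theta' h').
Proof.
move=> t2 t3; apply: isom_sym.
(* Otherwise -9 = -1, that is, 2^3 = 0. This selects the second branch of [st_a12_mx] for theta'. *)
have t'2 : theta' ^+ 2 != -1.
  apply/eqP => t'2; have : (3%:R * theta') ^+ 2 = theta ^+ 2.
    by rewrite t3 mulNr sqrrN exprMn sqrr_sign mul1r.
  rewrite exprMn t'2 t2 => /eqP; rewrite -subr_eq0.
  have -> : 3%:R ^+ 2 * -1 - -1 = - (2%:R ^+ 3) :> k by ring.
  by rewrite oppr_eq0 expf_eq0 (negbTE n2) andbF.
set v := st_v k; set w := st_w k.
have [[sv sw] [rv rw] _] := st_canonical k.
have [av aw] := st_a12_i t2; have [a'v a'w] := st_a12_i3 t'2.
(* f^2 = -3, whence the inverse g = - f / 3. *)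
pose f : {linear 'rV[k]_2 -> 'rV[k]_2} := st_map (v - 2%:R *: w) (2%:R *: v - w).
pose g : {linear 'rV[k]_2 -> 'rV[k]_2} :=
  st_map (3%:R^-1 *: (2%:R *: w - v)) (3%:R^-1 *: (w - 2%:R *: v)).
have fv : f v = v - 2%:R *: w by apply: st_map_v.
have fw : f w = 2%:R *: v - w by apply: st_map_w.
have gv : g v = 3%:R^-1 *: (2%:R *: w - v) by apply: st_map_v.
have gw : g w = 3%:R^-1 *: (w - 2%:R *: v) by apply: st_map_w.
clearbody f g.
have fL := (linearD f, linearN f, linearZ_LR f).
have gL := (linearD g, linearN g, linearZ_LR g).
have gK : cancel g f.
  apply: (st_ext (f := f \o g) (g := idfun)) => /=; rewrite -/v -/w ?gv ?gw !fL fv fw;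
  by module_coefs k ('rV[k]_2 : lmodType k); field.
have fK : cancel f g.
  apply: (st_ext (f := g \o f) (g := idfun)) => /=; rewrite -/v -/w ?fv ?fw !gL gv gw;
  by module_coefs k ('rV[k]_2 : lmodType k); field.
have [fs fr fa] : [/\ forall z, f (st_H k (val t12) z) = - st_H k (val t12) (f z),
    forall z, f (st_H k (val t23) z) = - st_H k (val t23) (f z) &
    forall z, f (st_a12 theta' z) = (-1) ^+ c *: st_a12 theta (f z)].
  rewrite -/v -/w in sv sw rv rw av aw a'v a'w.
  move: (st_H k (val t12)) (st_H k (val t23)) (st_a12 theta) (st_a12 theta')
    sv sw rv rw av aw a'v a'w => s r a a' sv sw rv rw av aw a'v a'w.
  have L := (linearD s, linearN s, linearZ_LR s, linearD r, linearN r, linearZ_LR r,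
    linearD a, linearN a, linearZ_LR a, linearD a', linearN a', linearZ_LR a').
  have t3' : theta' = 3%:R^-1 * - (-1) ^+ c * theta by rewrite -mulrA -t3 mulKf.
  split.
  - apply: (st_ext (f := f \o s) (g := \- (s \o f))) => /=;
      rewrite -/v -/w ?sv ?sw ?fv ?fw !L ?sv ?sw ?fv ?fw;
      by module_coefs k ('rV[k]_2 : lmodType k); ring.
  - apply: (st_ext (f := f \o r) (g := \- (r \o f))) => /=;
      rewrite -/v -/w ?rv ?rw ?fL ?fv ?fw !L ?rv ?rw ?fv ?fw;
      by module_coefs k ('rV[k]_2 : lmodType k); ring.
  - apply: (st_ext (f := f \o a') (g := ((-1) ^+ c) \*: (a \o f))) => /=;
      rewrite -/v -/w ?a'v ?a'w ?fL ?fv ?fw !L ?av ?aw ?fv ?fw t3';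
      by module_coefs k ('rV[k]_2 : lmodType k); field.
exists (f : {linear S_st theta' h' -> twist true c (S_st theta h)}); last by exists g.
apply: hom_generators => z; rewrite ?twist_mH ?twist_ma ?sgn_transp ?S_st_a12.
- by rewrite scaleN1r; exact: fs.
- by rewrite scaleN1r; exact: fr.
- exact: fa.
Qed.

End Standard.

(** * The projective module *)

Section BasisMap.

Variables (k : fieldType) (V : vectType k) (W : lmodType k) (n : nat).
Variables (X : n.-tuple V) (Y : seq W).

Definition basis_map_fun (z : V) : W := \sum_(j < n) coord X j z *: Y`_j.

Fact basis_map_linear : linear basis_map_fun.
Proof.
move=> c z z'; rewrite /basis_map_fun scaler_sumr -big_split.
by apply: eq_bigr => j _; rewrite linearP scalerDl scalerA.
Qed.

HB.instance Definition _ :=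
  GRing.isLinear.Build k V W _ basis_map_fun basis_map_linear.

Definition basis_map : {linear V -> W} := basis_map_fun.

Hypothesis X_basis : basis_of fullv X.

Lemma basis_mapE (j : 'I_n) : basis_map X`_j = Y`_j.
Proof.
have Xfree := basis_free X_basis.
rewrite /= /basis_map_fun (bigD1 j) //= coord_free // eqxx scale1r big1 ?addr0 // => l lj.
by rewrite coord_free // eq_sym (negbTE lj) scale0r.
Qed.

Lemma basis_ext (f g : {linear V -> W}) :
  (forall j : 'I_n, f X`_j = g X`_j) -> f =1 g.
Proof.
move=> fg z; rewrite (coord_basis X_basis (memvf z)) !linear_sum.
by apply: eq_bigr => j _; rewrite !linearZ_LR fg.
Qed.

End BasisMap.

(** * The action on P and its universal property *)

Section Cover.

Variables (k : fieldType) (n2 : 2%:R != 0 :> k) (n3 : 3%:R != 0 :> k).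
Variables (i : k) (i2 : i ^+ 2 = -1).
Variables (P : vectType k) (H : 'S_3 -> {linear P -> P}) (H_action : s3_action H).
Variables (x y u t v w : P) (P_basis : basis_of fullv [:: x; y; u; t; v; w]).
Hypotheses (Hx : forall s, H s x = x) (Hy : forall s, H s y = sgn k s *: y)
  (Hut : canonical_pair H u t) (Hvw : canonical_pair H v w).

Let B := [tuple x; y; u; t; v; w].

Lemma cover_ext (W : lmodType k) (f g : {linear P -> W}) :
  f x = g x -> f y = g y -> f u = g u -> f t = g t -> f v = g v -> f w = g w ->
  f =1 g.
Proof.
move=> *; apply: (basis_ext (X := B)) => // j.
by case: j => [[|[|[|[|[|[|//]]]]]]].
Qed.

Lemma cover_map (W : lmodType k) (x' y' u' t' v' w' : W) :
  exists f : {linear P -> W},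
  [/\ f x = x', f y = y' & f u = u'] /\ [/\ f t = t', f v = v' & f w = w'].
Proof.
exists (basis_map B [:: x'; y'; u'; t'; v'; w']).
have E j (j6 : (j < 6)%N) := basis_mapE [:: x'; y'; u'; t'; v'; w']
  (P_basis : basis_of fullv B) (Ordinal j6).
by split; split; [apply: (E 0%N) | apply: (E 1%N) | apply: (E 2%N) | apply: (E 3%N)
  | apply: (E 4%N) | apply: (E 5%N)].
Qed.

Let Hy12 : H (val t12) y = - y. Proof. by rewrite Hy sgn_transp scaleN1r. Qed.
Let Hy23 : H (val t23) y = - y. Proof. by rewrite Hy sgn_transp scaleN1r. Qed.

Lemma cover_action_exists : exists act : a1_action P,
  (forall s z, actH act s z = H s z) /\
  [/\ acta act t12 x = (2%:R * i) *: (u - t),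
      acta act t12 y = x + u + t,
      acta act t12 u = - i *: (u - t),
      acta act t12 t = - i *: (u - t) &
      acta act t12 v = x - (2%:R * i) *: y + u + t + i *: (v - w)].
Proof.
have [[su st] [ru rt] _] := Hut; have [[sv sw] [rv rw] _] := Hvw.
(* The value at w is forced by a_12 w = - H_12 a_12 v; the relations are then checked on the
   basis. *)
have [a [[ax ay au] [at_ av aw]]] := cover_map ((2%:R * i) *: (u - t)) (x + u + t)
  (- i *: (u - t)) (- i *: (u - t)) (x - (2%:R * i) *: y + u + t + i *: (v - w))
  (- (x + (2%:R * i) *: y + u + t + i *: (w - v))).
have gens : generator_relations (H (val t12)) (H (val t23)) a.
  have ss := action_transpK H_action t12; have rr := action_transpK H_action t23.
  have rsr := action_braid H_action.
  move: (Hx (val t12)) (Hx (val t23)) Hy12 Hy23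
    su st ru rt sv sw rv rw ss rr rsr ax ay au at_ av aw.
  move: (H (val t12)) (H (val t23)) => s r sx rx sy ry
    su st ru rt sv sw rv rw ss rr rsr ax ay au at_ av aw.
  have L := (linearD s, linearN s, linearZ_LR s, linearD r, linearN r, linearZ_LR r,
    linearD a, linearN a, linearZ_LR a).
  pose E := (sx, rx, sy, ry, su, st, ru, rt, sv, sw, rv, rw, ax, ay, au, at_, av, aw).
  have sa z : s (a z) = - a (s z).
    move: z; apply: (cover_ext (f := s \o a) (g := \- (a \o s))) => /=;
    by rewrite !(L, E); module_coefs k P; ring.
  split=> //.
    apply: (cover_ext (f := a \o a) (g := \0)) => /=;
      by rewrite !(L, E); module_coefs k P; ring: i2.
  (* The quadratic relation is minus the sum of the conjugates of d under the
     cyclic subgroup of order 3. *)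
  pose d : {linear P -> P} := r \o a \o r \o a.
  have quadE z : a (s (r (a (r (s z))))) + s (r (a (s (r (a (s (r z))))))) - r (a (r (a z)))
      = - s (r (d (r (s z)))) - r (s (d (s (r z)))) - d z.
    have as_ z' : a (s z') = - s (a z') by rewrite sa opprK.
    by rewrite /d /= rr rsr !as_ (linearN r) (linearN s).
  (* Tabulating d on the basis and then forgetting its definition keeps the final check small. *)
  have dE : [/\ d x = 2%:R *: u, d y = (3%:R * i) *: u & d u = - u] /\ [/\ d t = - u,
      d v = (3%:R * i) *: x - 2%:R *: y + (6%:R * i) *: (u - t) - v &
      d w = (3%:R * i) *: x - 2%:R *: y - (6%:R * i) *: t - v].
    by split; split; rewrite /d /= !(L, E); module_coefs k P; ring: i2.
  move: d quadE dE => d quadE [[dx dy du] [dt dv dw]] z; rewrite {}quadE; move: z.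
  apply: (cover_ext
    (f := \- (s \o (r \o (d \o (r \o s)))) \- (r \o (s \o (d \o (s \o r)))) \- d)
    (g := idfun \- (s \o r))) => /=;
    by rewrite !(L, E, linearD d, linearN d, linearZ_LR d, dx, dy, du, dt, dv, dw);
      module_coefs k P; ring: i2.
have [act [actE aE]] := generators_action H_action gens.
by exists act; split=> //; rewrite !aE.
Qed.

Section GivenAction.

Variable act : a1_action P.
Hypothesis actE : forall s z, actH act s z = H s z.
Hypotheses (ax : acta act t12 x = (2%:R * i) *: (u - t))
  (ay : acta act t12 y = x + u + t)
  (au : acta act t12 u = - i *: (u - t))
  (av : acta act t12 v = x - (2%:R * i) *: y + u + t + i *: (v - w)).

Let M : fd_a1_module k := FDModule act.

Local Notation s12 N := (mH N (val t12)).
Local Notation s23 N := (mH N (val t23)).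
Local Notation a12 N := (ma N t12).
Local Notation TpM N := (Tp (s12 N) (s23 N) (a12 N)).
Local Notation TmM N := (Tm (s12 N) (s23 N) (a12 N)).
Local Notation pr_vM N := (pr_v (s12 N) (s23 N)).
Local Notation standard N := (standard_v (s12 N) (s23 N)).

Let gens (N : a1_module k) := @module_generators k N.

Let mHE g z : mH M g z = H g z. Proof. exact: actE. Qed.

Let i_neq0 : i != 0.
Proof. by apply: contra_eq_neq i2 => ->; rewrite expr0n eq_sym oppr_eq0 oner_neq0. Qed.

Lemma cover_v_standard : standard M v.
Proof. by have [[sv _] [rv _] _] := Hvw; rewrite /standard_v !mHE sv. Qed.

Lemma cover_u_standard : standard M u.
Proof. by have [[su _] [ru _] _] := Hut; rewrite /standard_v !mHE su. Qed.

(** As H_12 u = t and H_12 v = w, the formula for a_12 v already displays its decomposition, with p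
    = u and q = i v. *)
Lemma cover_v_components :
  [/\ pr_triv (s12 M) (s23 M) (a12 M v) = x,
      pr_sgn (s12 M) (s23 M) (a12 M v) = - (2%:R * i) *: y,
      TpM M v = u & TmM M v = i *: v].
Proof.
have [[sv sw] [rv rw] _] := Hvw; have [[su st] [ru rt] _] := Hut.
apply: decomposition_unique; rewrite // ?mHE ?Hx //.
- by rewrite linearZ_LR Hy12 scalerN.
- by rewrite linearZ_LR Hy23 scalerN.
- exact: cover_u_standard.
- exact/standard_vZ/cover_v_standard.
by rewrite [LHS]av (linearZ_LR (H _)) su sv; module_coefs k P; ring.
Qed.

Lemma cover_Tm_u : TmM M u = - i *: u.
Proof.
have [[su _] _ _] := Hut.
have [|||||||_ _ _ //] := decomposition_unique n2 n3 (gens M) (n := u) (x := 0) (y := 0)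
  (p := 0) (q := - i *: u); rewrite ?linear0 ?oppr0 //.
- by rewrite -(scale0r (u : M)); exact/standard_vZ/cover_u_standard.
- exact/standard_vZ/cover_u_standard.
by rewrite [LHS]au ?mHE (linearZ_LR (H _)) su; module_coefs k P; ring.
Qed.

(** x, y and u are natural components of a_12 v, y up to the factor -2i, while t = H_12 u and w =
    H_12 v; so the value at v determines the rest. *)
Lemma cover_hom_unique (N : a1_module k) (f g : {linear M -> N}) :
  a1_hom f -> a1_hom g -> f v = g v -> f =1 g.
Proof.
move=> [fH fa] [gH ga] fg; have [vx vy vu _] := cover_v_components.
have [[sv _] _ _] := Hvw; have [[su _] _ _] := Hut.
have fgx : f x = g x.
  by rewrite -vx (intertwine_triv (fH _) (fH _)) (intertwine_triv (gH _) (gH _)) fa ga fg.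
have fgy : f y = g y.
  have ye : y = (- (2%:R * i))^-1 *: (- (2%:R * i) *: y).
    by rewrite scalerK // oppr_eq0 mulf_neq0 ?i_neq0.
  by rewrite ye -vy (linearZ_LR f) (linearZ_LR g) (intertwine_sgn (fH _) (fH _))
    (intertwine_sgn (gH _) (gH _)) fa ga fg.
have fgu : f u = g u.
  by rewrite -vu (intertwine_Tp (fH _) (fH _) (fa _))
    (intertwine_Tp (gH _) (gH _) (ga _)) fg.
apply: cover_ext => //.
  by rewrite -su -mHE [LHS]fH [RHS]gH fgu.
by rewrite -sv -mHE [LHS]fH [RHS]gH fg.
Qed.

Lemma cover_lift (N : a1_module k) (n : N) : standard N n -> TmM N n = i *: n ->
  exists2 f : {linear M -> N}, a1_hom f & f v = n.
Proof.
move=> sn En; have [aX aY aU] := eigen_action n2 n3 (gens N) i2 sn En.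
have [[su st] [ru rt] _] := Hut; have [[sv sw] [rv rw] _] := Hvw.
have an := a_decomposition n2 n3 (gens N) n; rewrite En in an.
have sX := s_pr_triv (gens N) (a12 N n); have rX := r_pr_triv (gens N) (a12 N n).
have sY := s_pr_sgn (gens N) (a12 N n); have rY := r_pr_sgn (gens N) (a12 N n).
have sU : standard N (TpM N n) by apply: Tp_standard.
have ss := gen_ss (gens N); have sa := gen_sa (gens N).
have rsU := standard_vs (gens N) sU; have rsn := standard_vs (gens N) sn.
have as_ z : a12 N (s12 N z) = - s12 N (a12 N z) by rewrite sa opprK.
have asM z : a12 M (H (val t12) z) = - H (val t12) (a12 M z).
  by rewrite -!mHE (gen_sa (gens M)) opprK.
have at_ : a12 M t = - i *: (u - t).
  rewrite -{1}su asM [a12 M u]au (linearZ_LR (H _)) (linearB (H _)) su st.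
  by module_coefs k P; ring.
have aw : a12 M w = - (x + (2%:R * i) *: y + u + t + i *: (w - v)).
  rewrite -{1}sv asM [a12 M v]av !(linearD (H _), linearN (H _), linearZ_LR (H _)).
  by rewrite su st sv sw Hx Hy12; module_coefs k P; ring.
(* Naturality of the components forces these values; i / 2 is the inverse of the coefficient -2i of
   y in a_12 v. *)
have [f [[fx fy fu] [ft fv fw]]] := cover_map (pr_triv (s12 N) (s23 N) (a12 N n))
  ((i / 2%:R) *: pr_sgn (s12 N) (s23 N) (a12 N n)) (TpM N n) (s12 N (TpM N n)) n (s12 N n).
exists f => //.
move: (pr_triv _ _ (a12 N n)) (pr_sgn _ _ (a12 N n)) (TpM N n)
  aX aY aU an sX rX sY rY sU rsU rsn sn {En sa} as_
  fx fy fu ft fv fw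
  => X Y U aX aY aU an sX rX sY rY sU rsU rsn sn as_ fx fy fu ft fv fw.
have fL := (linearD f, linearN f, linearZ_LR f).
have [sL rL] : (forall c z, s12 N (c *: z) = c *: s12 N z) /\
    (forall c z, s23 N (c *: z) = c *: s23 N z) by split=> *; exact: linearZ_LR.
have sD z z' : s12 N (z + z') = s12 N z + s12 N z' by exact: linearD.
have sN z : s12 N (- z) = - s12 N z by exact: linearN.
have aL c z : a12 N (c *: z) = c *: a12 N z by exact: linearZ_LR.
have [fs fr fa] : [/\ forall z, f (H (val t12) z) = s12 N (f z),
    forall z, f (H (val t23) z) = s23 N (f z) & forall z, f (a12 M z) = a12 N (f z)].
  have := (ax : a12 M x = _, ay : a12 M y = _, au : a12 M u = _, av : a12 M v = _).
  move: (a12 M : {linear P -> P}) at_ aw => a at_ aw [[[ax' ay'] au'] av'].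
  split.
  - apply: (cover_ext (f := f \o H (val t12)) (g := s12 N \o f));
      rewrite -![LHS]/(f (H _ _)) -![RHS]/(s12 N (f _)).
    + by rewrite Hx fx sX.
    + by rewrite Hy12 fL fy sL sY scalerN.
    + by rewrite su ft fu.
    + by rewrite st ft fu ss.
    + by rewrite sv fw fv.
    + by rewrite sw fw fv ss.
  - apply: (cover_ext (f := f \o H (val t23)) (g := s23 N \o f));
      rewrite -![LHS]/(f (H _ _)) -![RHS]/(s23 N (f _)).
    + by rewrite Hx fx rX.
    + by rewrite Hy23 fL fy rL rY scalerN.
    + by rewrite ru !fL ft fu sU.
    + by rewrite rt fL ft rsU.
    + by rewrite rv !fL fw fv sn.
    + by rewrite rw fL fw rsn.
  - apply: (cover_ext (f := f \o a) (g := a12 N \o f));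
      rewrite -![LHS]/(f (a _)) -![RHS]/(a12 N (f _)).
    + by rewrite ax' !fL ft fu fx aX.
    + by rewrite ay' !fL ft fu fx fy aL aY; module_coefs k (N : lmodType k); field: i2.
    + by rewrite au' !fL ft fu aU.
    + by rewrite at_ !fL ft fu as_ aU sL !(sD, sN) ss;
        module_coefs k (N : lmodType k); ring.
    + by rewrite av' !fL ft fu fv fw fx fy an sL;
        module_coefs k (N : lmodType k); field: i2.
    + rewrite aw !fL ft fu fv fw fx fy as_ an !(sD, sN, sL, ss, sX, sY).
      by module_coefs k (N : lmodType k); field: i2.
by apply: hom_generators => z; rewrite ?mHE.
Qed.

Lemma cover_projective : a1_projective M.
Proof.
move=> N L g f [gH ga] gsurj fhom; have [fH fa] := fhom.
have [_ _ _ Tv] := cover_v_components.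
have [m gm] := gsurj (f v).
(* A preimage of f v need not be standard; since g commutes with [pr_v], which fixes f v, its
   projection is a standard preimage. *)
have sm : standard N (pr_vM N m) by apply: pr_v_standard.
have gpm : g (pr_vM N m) = f v.
  rewrite (intertwine_v (gH _) (gH _)) gm -(intertwine_v (fH _) (fH _)).
  by rewrite (pr_v_id n3 (gens M) cover_v_standard).
move: (pr_vM N m) sm gpm => {gm}m sm gm.
have [sn Tn] := eigen_projection n2 n3 (gens N) i2 sm.
have [h hhom hv] := cover_lift sn Tn.
exists h => //; apply: (cover_hom_unique (f := g \o h)) => //.
  exact: hom_comp hhom (conj gH ga).
have gT := intertwine_Tm (gH (val t12)) (gH (val t23)) (ga t12).
have Tfv : TmM L (f v) = i *: f v.
  by rewrite -(intertwine_Tm (fH _) (fH _) (fa _)) Tv linearZ_LR.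
(* T- is i on f v, so the eigenprojection acts there by - (i^2 - i i^3) / 2 = 1. *)
rewrite -[LHS]/(g (h v)) hv linearZ_LR (linearB g) (linearZ_LR g) !gT gm.
rewrite !(Tfv, linearZ_LR (TmM L)).
by module_coefs k (L : lmodType k); field: i2.
Qed.

(** The operators that extract x, y and u from a_12 v are combinations of the generators of the
    algebra, so they preserve U. *)
Lemma cover_submodule_v (U : M -> Prop) : a1_submodule U -> U v -> forall z, U z.
Proof.
move=> Usub Uv; have [vx vy vu _] := cover_v_components.
have [[sv _] _ _] := Hvw; have [[su _] _ _] := Hut.
case: Usub => U0 UD UZ UH Ua.
have UB z z' : U z -> U z' -> U (z - z').
  by move=> Uz Uz'; apply: UD => //; rewrite -scaleN1r; apply: UZ.
have Uav : U (a12 M v) by exact: Ua.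
have Ux : U x.
  by rewrite -vx pr_trivE; repeat first [exact Uav | apply/UD | apply/UH | apply/UZ].
have Uy : U y.
  have -> : y = (- (2%:R * i))^-1 *: (- (2%:R * i) *: y).
    by rewrite scalerK // oppr_eq0 mulf_neq0 ?i_neq0.
  by rewrite -vy pr_sgnE; apply/UZ;
    repeat first [exact Uav | apply/UB | apply/UD | apply/UH | apply/UZ].
have Uu : U u.
  by rewrite -vu TpE pr_vE;
    repeat first [exact Uav | apply/UB | apply/UD | apply/UH | apply/UZ].
have Ut : U t by rewrite -su -mHE; apply: UH.
have Uw : U w by rewrite -sv -mHE; apply: UH.
move=> z; rewrite (coord_basis (P_basis : basis_of fullv B) (memvf z)).
by apply: (big_ind U) => // -[[|[|[|[|[|[|//]]]]]] p] _; apply: UZ.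
Qed.

Lemma cover_pr_v z : exists c d, pr_vM M z = c *: u + d *: v.
Proof.
have [[su _] _ _] := Hut; have [[sv _] _ _] := Hvw.
have pL := (linearD (pr_vM M), linearZ_LR (pr_vM M)).
rewrite (coord_basis (P_basis : basis_of fullv B) (memvf z)) !big_ord_recl big_ord0 /= !pL.
rewrite (pr_v_id n3 (gens M) cover_u_standard) (pr_v_id n3 (gens M) cover_v_standard).
have -> : pr_vM M x = 0 by apply: pr_v_triv; rewrite mHE Hx.
have -> : pr_vM M y = 0 by apply: pr_v_sgn; rewrite mHE ?Hy12 ?Hy23.
have -> : pr_vM M t = 0 by rewrite -su -mHE; apply: pr_v_s cover_u_standard; apply: gens.
have -> : pr_vM M w = 0 by rewrite -sv -mHE; apply: pr_v_s cover_v_standard; apply: gens.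
by rewrite (linear0 (pr_vM M)) !scaler0 !add0r !addr0; do 2!eexists.
Qed.

Lemma cover_is_projective_cover (h : st_param i) : is_projective_cover M (S_st i h).
Proof.
split; first exact: cover_projective.
pose S := S_st i h.
have [[stv stw] [rtv rtw] _] := st_canonical k; have [av' aw'] := st_a12_i i2.
have st_std : standard S (st_v k).
  by rewrite /standard_v !S_st_H stv rtv.
have [_ _ Tpv Tmv] : [/\ pr_triv (s12 S) (s23 S) (a12 S (st_v k)) = 0,
  pr_sgn (s12 S) (s23 S) (a12 S (st_v k)) = 0,
  TpM S (st_v k) = 0 & TmM S (st_v k) = i *: st_v k].
  have std0 : standard S 0 by rewrite -(scale0r (st_v k : S)); exact/standard_vZ.
  apply: decomposition_unique; rewrite ?linear0 ?oppr0 //; first exact/standard_vZ.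
  rewrite !addr0 add0r S_st_a12 av' linearZ_LR S_st_H stv.
  by rewrite scalerBr.
have [f fhom fv] := cover_lift st_std Tmv; have [fH fa] := fhom.
exists f => //; split=> [q|U Usub Usurj].
  exists (q 0 0 *: v + q 0 1 *: (s12 M v)).
  by rewrite (linearD f) !(linearZ_LR f) fH fv S_st_H stv -st_coord.
apply: cover_submodule_v => //.
have [z Uz fz] := Usurj (st_v k).
have [_ _ Tpu Tv] := cover_v_components.
have [c [d pz]] := cover_pr_v z.
(* u = T+ v, and T+ kills the image of v in S_st(i). Hence only the coefficient d of v is seen by f,
   and it must be 1. *)
have fu : f u = 0 by rewrite -Tpu (intertwine_Tp (fH _) (fH _) (fa _)) fv.
have d1 : d = 1.
  have : f (pr_vM M z) = st_v k.
    by rewrite (intertwine_v (fH _) (fH _)) fz; apply: pr_v_id.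
  rewrite pz (linearD f) !(linearZ_LR f) fu fv scaler0 add0r => /eqP.
  rewrite -[X in _ == X]scale1r -subr_eq0 -scalerBl scaler_eq0.
  rewrite (negbTE (st_v_neq0 k)) orbF subr_eq0.
  by move/eqP.
case: Usub => U0 UD UZ UH Ua.
have UB z1 z2 : U z1 -> U z2 -> U (z1 - z2).
  by move=> Uz1 Uz2; apply: UD => //; rewrite -scaleN1r; apply: UZ.
have Upz : U (pr_vM M z).
  by rewrite pr_vE; repeat first [exact Uz | apply/UB | apply/UD | apply/UH | apply/UZ].
have UTm : U (TmM M (pr_vM M z)).
  rewrite TmE pr_vE.
  by repeat first [exact Upz | apply/UB | apply/UD | apply/UH | apply/Ua | apply/UZ].
(* T- is -i on u and i on v, so T- + i kills c u and multiplies v by 2i. *)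
have -> : v = (2%:R * i)^-1 *: (TmM M (pr_vM M z) + i *: pr_vM M z).
  have TL := (linearD (TmM M), linearZ_LR (TmM M)).
  have i0 := i_neq0.
  by rewrite pz d1 !TL cover_Tm_u Tv; module_coefs k P; field; rewrite ?i0 ?n2.
by apply/UZ/UD => //; apply/UZ.
Qed.

End GivenAction.
End Cover.

(** * The four projective covers *)

Theorem proposition5p15 (k : closedFieldType) (char0 : [pchar k] =i pred0)
    (i : k) (i2 : i ^+ 2 = -1)
    (P : vectType k) (H : 'S_3 -> {linear P -> P}) (H_action : s3_action H)
    (x y u t v w : P) (P_basis : basis_of fullv [:: x; y; u; t; v; w])
    (Hx : forall s, H s x = x) (Hy : forall s, H s y = sgn k s *: y)
    (Hut : canonical_pair H u t) (Hvw : canonical_pair H v w) :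
  let is_given_action (act : a1_action P) : Prop :=
    (forall s z, actH act s z = H s z) /\
    [/\ acta act t12 x = (2%:R * i) *: (u - t),
        acta act t12 y = x + u + t,
        acta act t12 u = - i *: (u - t),
        acta act t12 t = - i *: (u - t) &
        acta act t12 v = x - (2%:R * i) *: y + u + t + i *: (v - w)] in
  (exists act, is_given_action act) /\
  (forall act, is_given_action act ->
    let P_i : fd_a1_module k := FDModule act in
    [/\ is_projective_cover P_i (S_st i (st_param_i i2)),
        isom_projective_cover (S_st (- (i / 3%:R)) (st_param_Ni3 char0 i2))
          (tens_module P_i (S_sgn k)),
        isom_projective_cover (S_st (i / 3%:R) (st_param_i3 char0 i2))
          (tens_module (S_sgn k) P_i) &
        isom_projective_cover (S_st (- i) (st_param_Ni i2))
          (tens_module (tens_module (S_sgn k) P_i) (S_sgn k))]).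
Proof.
have /pcharf0P c0 := char0.
have n2 : 2%:R != 0 :> k by rewrite c0.
have n3 : 3%:R != 0 :> k by rewrite c0.
move=> is_given_action; split; first exact: cover_action_exists.
move=> act [actE [ax ay au at_ av]] P_i.
have cover : is_projective_cover P_i (S_st i (st_param_i i2)).
  exact: (cover_is_projective_cover n2 n3 i2 P_basis Hx Hy Hut Hvw actE ax ay au av).
have cover_l : is_projective_cover (tens_module (S_sgn k) P_i)
    (S_st (i / 3%:R) (st_param_i3 char0 i2)).
  apply: proj_cover_transport (sgn_tens_isom P_i) _ (proj_cover_twist true true cover).
  by apply: st_twist_sgn_isom => //; field.
split=> //; apply: isom_projective_coverP => //.
  apply: proj_cover_transport (tens_sgn_isom P_i) _ (proj_cover_twist true false cover).
  by apply: st_twist_sgn_isom => //; field.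
apply: proj_cover_transport (tens_sgn_isom _) _ (proj_cover_twist true false cover_l).
(* [st_twist_sgn_isom] starts from a square root of -1, here -i, whose twist is S_st(i/3);
   [twist_isom] reverses the direction. *)
apply: twist_isom; apply: st_twist_sgn_isom => //; first by rewrite sqrrN.
by field.
Qed.
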